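(* Let $w\colon(0,\infty)\to[0,\infty)$ be a measurable weight, positive almost everywhere, such that $\mu,\mu_h\in H_w'$, where $\mu=\sum_{k=1}^\infty\delta_{\lambda_k}$ and $\mu_h=\sum_{k=1}^{N_h}\delta_{\lambda_{k,h}}$ are the continuous and discrete spectral measures. Then for every $\psi\in H_w$ and every $1\le n\le N_h$, $$\left|\sum_{k=1}^n\psi(\lambda_{k,h})\right|\le\|\psi\|_{H_w}\,\|\mu_h\|_{H_w'}\le\|\psi\|_{H_w}\,\|\mu\|_{H_w'}.$$
   Context: Let $\Omega\subset\mathbb{R}^d$ be a bounded connected domain with Lipschitz boundary. $0<\lambda_1<\lambda_2\le\lambda_3\le\cdots\to\infty$ are the eigenvalues, counted with multiplicity, of the Dirichlet Laplacian: $-\Delta u_k=\lambda_k u_k$ in $\Omega$, $u_k=0$ on $\partial\Omega$. $V_h\subset H_0^1(\Omega)$ is a conforming finite element space of finite dimension $N_h$, and $0<\lambda_{1,h}\le\cdots\le\lambda_{N_h,h}$ are the discrete eigenvalues, counted with multiplicity: $\int_\Omega\nabla u_{k,h}\cdot\nabla v_h\,dx=\lambda_{k,h}\int_\Omega u_{k,h}v_h\,dx$ for all $v_h\in V_h$. By the min-max principle, $\lambda_k\le\lambda_{k,h}$ for $k=1,\dots,N_h$. For a weight $w$ such that $t\mapsto\sqrt{w(t)}\,e^{-\lambda t}$ lies in $L^2(0,\infty)$ for every $\lambda>0$, the weighted Laplace space $H_w$ is the reproducing kernel Hilbert space on $(0,\infty)$ with kernel $K(\lambda,\eta)=\int_0^\infty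 e^{-(\lambda+\eta)t}w(t)\,dt$. Equivalently, $H_w$ consists of the functions $f=\mathcal{L}g$, $f(x)=\int_0^\infty e^{-xt}g(t)\,dt$, with $g\in L^2(w^{-1})$, i.e. $\int_0^\infty g(t)^2\,dt/w(t)<\infty$, and $\|f\|_{H_w}=\|g\|_{L^2(w^{-1})}$. $H_w'$ is its dual, with measures acting by integration, $\langle\mu,f\rangle=\int_0^\infty f\,d\mu$. With $Z(t)=\sum_{k=1}^\infty e^{-\lambda_k t}$ and $Z_h(t)=\sum_{k=1}^{N_h}e^{-\lambda_{k,h}t}$, membership $\mu\in H_w'$ means $\int_0^\infty Z(t)^2w(t)\,dt<\infty$ (and likewise for $\mu_h$ with $Z_h$), and $$\|\mu\|_{H_w'}^2=\int_0^\infty Z(t)^2w(t)\,dt,\qquad \|\mu_h\|_{H_w'}^2=\int_0^\infty Z_h(t)^2w(t)\,dt.$$ *)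

(* Defs.v *)
From HB Require Import structures.
From mathcomp Require Import all_boot all_order all_algebra.
From mathcomp Require Import all_classical all_reals all_analysis.
Set Implicit Arguments.
Unset Strict Implicit.
Unset Printing Implicit Defensive.
Import Order.TTheory GRing.Theory Num.Theory.
Import numFieldNormedType.Exports.
Local Open Scope classical_set_scope.
Local Open Scope ring_scope.

(** * Lebesgue measure on R^d *)

Section measurable_rV.
Context {R : realType} (d : nat).

Let coors : 'I_d -> 'rV[R]_d -> measurableTypeR R := fun i x => x 0 i.

Let rV_set0 : g_sigma_preimage coors set0.
Proof. exact: sigma_algebra0. Qed.

Let rV_setC A : g_sigma_preimage coors A -> g_sigma_preimage coors (~` A).
Proof. exact: sigma_algebraC. Qed.

Let rV_bigcup (F : _^nat) : (forall i, g_sigma_preimage coors (F i)) ->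
  g_sigma_preimage coors (\bigcup_i (F i)).
Proof. exact: sigma_algebra_bigcup. Qed.

(* Same construction as the library's sigma-algebra on [d.-tuple T]; it is the
   Borel sigma-algebra of R^d. *)
HB.instance Definition _ :=
  @isMeasurable.Build (measure_tuple_display default_measure_display)
    'rV[R]_d (g_sigma_preimage coors) rV_set0 rV_setC rV_bigcup.

Lemma measurable_coord (i : 'I_d) :
  measurable_fun [set: 'rV[R]_d] (fun x => x 0 i : measurableTypeR R).
Proof.
move=> _ Y mY; rewrite setTI; apply: sub_sigma_algebra => /=.
rewrite -bigcup_seq/=; exists i => /=; first by rewrite mem_index_enum.
by exists Y => //; rewrite setTI.
Qed.

Lemma measurable_fun_rV d1 (T : measurableType d1) (f : T -> 'rV[R]_d) :
  (forall i, measurable_fun [set: T] (fun x => f x 0 i : measurableTypeR R)) ->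
  measurable_fun [set: T] f.
Proof.
move=> mf.
apply: (measurability (\big[setU/set0]_(i < d)
  preimage_set_system setT (coors i) measurable)) => //.
move=> _ [B + <-]; rewrite -bigcup_seq => -[i _ [C mC <-]].
rewrite !setTI; have := mf i measurableT C mC.
by rewrite setTI.
Qed.

End measurable_rV.

Section cons_measure.
Context {R : realType} (d : nat).
Variable m : {sigma_finite_measure set 'rV[R]_d -> \bar R}.

Definition consrV (p : measurableTypeR R * 'rV[R]_d) : 'rV[R]_d.+1 :=
  row_mx (p.1%:M : 'rV_1) p.2.

Definition cons_measure : set 'rV[R]_d.+1 -> \bar R :=
  pushforward (@lebesgue_measure R \x m)%E consrV.


Lemma consrV0 p : consrV p 0 0 = p.1.
Proof.
rewrite (_ : 0 = lshift d (0 : 'I_1)) ?[LHS](row_mxEl (p.1%:M : 'rV_1)).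
  by rewrite mxE eqxx.
exact: val_inj.
Qed.

Lemma consrVS p (i : 'I_d) : consrV p 0 (lift 0 i) = p.2 0 i.
Proof.
rewrite (_ : lift 0 i = rshift 1 i) ?[LHS](row_mxEr (p.1%:M : 'rV_1))//.
exact: val_inj.
Qed.

Lemma measurable_consrV : measurable_fun setT consrV.
Proof.
apply: measurable_fun_rV => i; have [j ->|->] := unliftP 0 i.
  under eq_fun do rewrite consrVS.
  exact: measurableT_comp (measurable_coord j) measurable_snd.
by under eq_fun do rewrite consrV0; exact: measurable_fst.
Qed.

Let cons_measure0 : cons_measure set0 = 0%E.
Proof. by rewrite /cons_measure /pushforward preimage_set0 measure0. Qed.

Let cons_measure_ge0 A : (0 <= cons_measure A)%E.
Proof. by rewrite /cons_measure /pushforward measure_ge0. Qed.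

Let cons_measure_sigma_additive : semi_sigma_additive cons_measure.
Proof.
move=> F mF tF mUF; rewrite /cons_measure /pushforward preimage_bigcup.
apply: measure_semi_sigma_additive.
- by move=> n; rewrite -[X in measurable X]setTI; exact: measurable_consrV.
- apply/trivIsetP => /= i j _ _ ij; rewrite -preimage_setI.
  by move/trivIsetP : tF => /(_ _ _ _ _ ij) ->//; rewrite preimage_set0.
- rewrite -preimage_bigcup -[X in measurable X]setTI.
  exact: measurable_consrV.
Qed.

HB.instance Definition _ := isMeasure.Build _ _ _ cons_measure
  cons_measure0 cons_measure_ge0 cons_measure_sigma_additive.

Let sigma_finite_cons_measure : sigma_finite setT cons_measure.
Proof.
pose unconsrV (v : 'rV[R]_d.+1) : measurableTypeR R * 'rV[R]_d :=
  (v 0 0, \row_j v 0 (lift 0 j)).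
have consK : cancel consrV unconsrV.
  move=> [x v]; congr (_, _); first exact: consrV0.
  by apply/rowP => j; rewrite mxE consrVS.
have m_uncons : measurable_fun setT unconsrV.
  apply/measurable_fun_pairP; split; first exact: measurable_coord.
  apply: measurable_fun_rV => i /=; under eq_fun do rewrite mxE.
  exact: measurable_coord.
have /sigma_finiteP[F [TF ndF Foo]] := sigma_finiteT (@lebesgue_measure R).
have /sigma_finiteP[G [TG ndG Goo]] := sigma_finiteT m.
exists (fun n => unconsrV @^-1` (F n `*` G n)).
  apply/seteqP; split=> // v _.
  have [i _ Fi] : (\bigcup_i F i) (unconsrV v).1 by rewrite -TF.
  have [j _ Gj] : (\bigcup_i G i) (unconsrV v).2 by rewrite -TG.
  exists (maxn i j) => //; split.
  - by move: Fi; apply/subsetPset/ndF/leq_maxl.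
  - by move: Gj; apply/subsetPset/ndG/leq_maxr.
move=> k; have [mF Fk] := Foo k; have [mG Gk] := Goo k; split.
  by rewrite -[X in measurable X]setTI; apply: m_uncons => //; exact: measurableX.
rewrite /cons_measure /pushforward -comp_preimage (_ : _ \o _ = id); last first.
  by apply/funext => p; exact: consK.
by rewrite preimage_id product_measure1E// lte_mul_pinfty// ge0_fin_numE.
Qed.

HB.instance Definition _ := Measure_isSigmaFinite.Build _ _ _ cons_measure
  sigma_finite_cons_measure.

End cons_measure.

(* Iterated product: a unit mass on R^0, then
   [lebesgue_measure \x lebesgue_rV d] through R * R^d ~ R^(d+1). *)
Fixpoint lebesgue_rV {R : realType} (d : nat) :
    {sigma_finite_measure set 'rV[R]_d -> \bar R} :=
  if d is d'.+1 then cons_measure (lebesgue_rV d') else \d_(0 : 'rV[R]_0).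

Lemma lebesgue_rV_rect {R : realType} d (A : 'I_d -> set (measurableTypeR R)) :
  (forall i, measurable (A i)) ->
  lebesgue_rV d [set x | forall i, A i (x 0 i)] =
  (\prod_(i < d) lebesgue_measure (A i))%E.
Proof.
elim: d A => [|d IH] A mA.
  by rewrite big_ord0 /= diracE mem_set// => -[].
rewrite big_ord_recl -IH//.
transitivity ((@lebesgue_measure R \x lebesgue_rV d)%E
    (A 0 `*`
    [set x : 'rV[R]_d | forall i : 'I_d, A (lift 0 i) (x 0 i)])); last first.
  rewrite product_measure1E//.
  rewrite (_ : [set x | _] = \bigcap_(i in [set: 'I_d])
    ((fun x : 'rV[R]_d => x 0 i : measurableTypeR R) @^-1` A (lift 0 i))).
    apply: fin_bigcap_measurable => // i _; rewrite -[X in measurable X]setTI.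
    exact: measurable_coord.
  by apply/seteqP; split=> x /= Ax i; [move=> _|]; exact: Ax.
congr (product_measure1 _ _ _); apply/seteqP; split=> -[x v] /= Axv.
  by split=> [|i]; [have := Axv 0; rewrite consrV0|
    have := Axv (lift 0 i); rewrite consrVS].
case: Axv => Ax Av i; have [j ->|->] := unliftP 0 i; rewrite (consrVS, consrV0)//=.
Qed.

(** * Domains and Sobolev spaces *)

Section sobolev.
Context {R : realType}.

(* Near every boundary point, after an orthogonal change of axes [O], the set is
   the strict epigraph of a Lipschitz function of the last [d] coordinates. *)
Definition lipschitz_boundary d (Omega : set 'rV[R]_d.+1) :=
  forall x0, (closure Omega `\` Omega°) x0 ->
  exists (O : 'M[R]_d.+1) (gamma : 'rV[R]_d -> R),
    [/\ O *m O^T = 1%:M,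
        exists k, forall y z, `|gamma y - gamma z| <= k * `|y - z| &
        \forall x \near x0, let y := x *m O in
          Omega x <-> gamma (col' 0 y) < y 0 0].

Definition bounded_lipschitz_domain d (Omega : set 'rV[R]_d.+1) :=
  [/\ Omega !=set0, open Omega, connected Omega, bounded_set Omega &
      lipschitz_boundary Omega].

Variable d : nat.
Implicit Types (Omega : set 'rV[R]_d) (f phi : 'rV[R]_d -> R).

Definition partial (i : 'I_d) f : 'rV[R]_d -> R :=
  fun x => 'D_(delta_mx 0 i) f x.

Definition gradient f : 'rV[R]_d -> 'rV[R]_d := fun x => \row_i partial i f x.

(* All iterated partial derivatives exist and are continuous. *)
Definition smooth f := forall s : seq 'I_d, let g := foldr partial f s in
  continuous g /\ forall x i, derivable g x (delta_mx 0 i).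

Definition test_function Omega phi :=
  [/\ smooth phi, compact (closure [set x | phi x != 0]) &
      closure [set x | phi x != 0] `<=` Omega].

Definition L2 Omega f := measurable_fun Omega f /\
  (\int[lebesgue_rV d]_(x in Omega) (f x ^+ 2)%:E < +oo)%E.

(* An element of H^1 is carried together with its weak gradient, which it
   determines almost everywhere.  Values outside the domain are irrelevant, and
   elements are to be compared almost everywhere in the domain. *)
Record sobolev_pair := SobolevPair {
  fct : 'rV[R]_d -> R ;
  grad : 'rV[R]_d -> 'rV[R]_d }.

Implicit Types (p q : sobolev_pair) (V W : set sobolev_pair).

Definition weak_gradient Omega p := forall phi i, test_function Omega phi ->
  \int[lebesgue_rV d]_(x in Omega) (fct p x * partial i phi x) =
  - \int[lebesgue_rV d]_(x in Omega) (grad p x 0 i * phi x).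

Definition H1 Omega : set sobolev_pair := [set p |
  [/\ L2 Omega (fct p), forall i, L2 Omega (fun x => grad p x 0 i) &
      weak_gradient Omega p]].

Definition l2_dot Omega p q : R :=
  \int[lebesgue_rV d]_(x in Omega) (fct p x * fct q x).

Definition dirichlet_form Omega p q : R :=
  \int[lebesgue_rV d]_(x in Omega) \sum_(i < d) grad p x 0 i * grad q x 0 i.

Definition sub_pair p q : sobolev_pair :=
  SobolevPair (fun x => fct p x - fct q x) (fun x => grad p x - grad q x).

(* H^1_0: the closure in H^1 of the test functions. *)
Definition H10 Omega : set sobolev_pair := [set p | H1 Omega p /\
  forall e : R, 0 < e -> exists2 phi, test_function Omega phi &
    let r := sub_pair p (SobolevPair phi (gradient phi)) in
    l2_dot Omega r r + dirichlet_form Omega r r < e].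

(** * Eigenvalues *)

Definition lincomb (I : Type) (s : seq I) (c : I -> R) (u : I -> sobolev_pair)
    : 'rV[R]_d -> R :=
  fun x => \sum_(i <- s) c i * fct (u i) x.

(* The [u i] with [P i] form a (Hamel) basis of [W], modulo equality a.e. *)
Definition basis_of Omega W (I : eqType) (P : pred I) (u : I -> sobolev_pair) :=
  [/\ forall i, P i -> W (u i),
      forall (s : seq I) (c : I -> R), uniq s -> all P s ->
        ae_eq (lebesgue_rV d) Omega (lincomb s c u) (cst 0) ->
        forall i, i \in s -> c i = 0 &
      forall p, W p -> exists (s : seq I) (c : I -> R),
        all P s /\ ae_eq (lebesgue_rV d) Omega (fct p) (lincomb s c u)].

Definition eigenspace_in Omega V (l : R) : set sobolev_pair := [set p |
  V p /\ forall q, V q -> dirichlet_form Omega p q = l * l2_dot Omega p q].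

(* [lam] lists all the eigenvalues on [V], each [l] being repeated as many times
   as the dimension of its eigenspace. *)
Definition eigenvalues_with_multiplicity Omega V (I : eqType) (lam : I -> R) :=
  exists u : I -> sobolev_pair, forall l,
    basis_of Omega (eigenspace_in Omega V l) (fun i => lam i == l) u.

(* Indices start at 0: [lam k] is the (k+1)-st eigenvalue. *)
Definition dirichlet_eigenvalues Omega (lam : R^nat) :=
  [/\ 0 < lam 0%N, lam 0%N < lam 1%N, {homo lam : i j / (i <= j)%N >-> i <= j},
      lam k @[k --> \oo] --> +oo &
      eigenvalues_with_multiplicity Omega (H10 Omega) lam].

Definition conforming_space Omega (N : nat) V :=
  [/\ V `<=` H10 Omega,
      forall (a : R) p q, V p -> V q ->
        V (SobolevPair (fun x => a * fct p x + fct q x)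
                       (fun x => a *: grad p x + grad q x)) &
      exists b : 'I_N -> sobolev_pair, basis_of Omega V predT b].

(* Only the first [N] values of [lam] are meaningful. *)
Definition discrete_eigenvalues Omega V (N : nat) (lam : R^nat) :=
  [/\ forall i, (i < N)%N -> 0 < lam i,
      forall i j, (i <= j < N)%N -> lam i <= lam j &
      eigenvalues_with_multiplicity Omega V (fun i : 'I_N => lam i)].

End sobolev.
Arguments sobolev_pair R d : clear implicits.

(** * Weighted Laplace spaces *)

Section laplace.
Context {R : realType}.
Local Notation mu1 := (@lebesgue_measure R).
Local Notation Rpos := (`]0%R, +oo[%classic : set (measurableTypeR R)).
Implicit Types (w psi g : R -> R)
  (nu : {measure set R -> \bar R}).

Definition weight w :=
  [/\ measurable_fun Rpos w, forall t, 0 < t -> 0 <= w t &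
      {ae mu1, forall t, 0 < t -> 0 < w t}].

(* [sqrt w(t) e^(- l t)] is square-integrable for every [l > 0]; this is what
   makes the kernel, hence the space H_w, well defined. *)
Definition laplace_weight w := forall l : R, 0 < l ->
  (\int[mu1]_(t in Rpos) ((Num.sqrt (w t) * expR (- l * t)) ^+ 2)%:E
    < +oo)%E.

Definition laplace g (x : R) : R :=
  \int[mu1]_(t in Rpos) (expR (- x * t) * g t).

Definition sqnorm_winv w g : \bar R :=
  (\int[mu1]_(t in Rpos) (g t ^+ 2 / w t)%:E)%E.

Definition laplace_density w psi : set (R -> R) := [set g |
  [/\ measurable_fun Rpos g, (sqnorm_winv w g < +oo)%E &
      forall x, 0 < x -> psi x = laplace g x]].

Definition Hw w : set (R -> R) := [set psi | exists g, laplace_density w psi g].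

(* The density is unique a.e., by injectivity of the Laplace transform, so the
   norm does not depend on the density chosen. *)
Definition Hw_norm w psi : R :=
  Num.sqrt (fine (sqnorm_winv w (xget (cst 0) (laplace_density w psi)))).

(* The function Z attached to a measure on (0, +oo). *)
Definition laplace_measure nu (t : R) : \bar R :=
  (\int[nu]_(x in Rpos) (expR (- x * t))%:E)%E.

Definition Hw_dual_sqnorm w nu : \bar R :=
  (\int[mu1]_(t in Rpos) (laplace_measure nu t ^+ 2 * (w t)%:E))%E.

Definition Hw_dual w : set {measure set R -> \bar R} :=
  [set nu | (Hw_dual_sqnorm w nu < +oo)%E].

Definition Hw_dual_norm w nu : R := Num.sqrt (fine (Hw_dual_sqnorm w nu)).

Definition spectral_measure (lam : R^nat) :
    {measure set R -> \bar R} :=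
  mseries (fun k => \d_(lam k)) 0.

Definition discrete_spectral_measure (N : nat) (lam : R^nat) :
    {measure set R -> \bar R} :=
  msum (fun k => \d_(lam k)) N.

End laplace.

(* Main.v *)
Require Import Defs.
From HB Require Import structures.
From mathcomp Require Import all_boot all_order all_algebra.
From mathcomp Require Import all_classical all_reals all_analysis.
From mathcomp Require Import measurable_realfun ring lra.
Import Order.TTheory GRing.Theory Num.Theory.
Import numFieldNormedType.Exports.
Local Open Scope classical_set_scope.
Local Open Scope ring_scope.
Set Implicit Arguments.
Unset Strict Implicit.
Unset Printing Implicit Defensive.

(** The first inequality is the Cauchy-Schwarz inequality. If [psi] is the
    Laplace transform of [g], the sum of the [psi (lamh k)] for [k < n] is the
    integral of [Z_n * g], where [Z_n] is the partial sum of the exponentials;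
    writing [Z_n * g] as [(sqrt w * Z_n) * (g / sqrt w)] bounds it by the norm
    of [psi] times the weighted norm of [Z_n], and [Z_n] is at most [Z_h]
    ([Hw_sum_le]).

    The second inequality compares [Z_h] with [Z] pointwise
    ([Hw_dual_sqnorm_le]) and therefore rests on [lam k <= lamh k] for [k < N]
    ([eigenvalue_le]). The eigenvalues are only known as a list of all the
    weak eigenvalues with multiplicity, so the min-max principle has to be
    derived from the compactness of the embedding of H^1_0 in L^2. If
    [lamh k < lam k], a dimension count provides a combination [u] of the first
    [k + 1] discrete eigenvectors that is orthogonal to the first [k]
    eigenfunctions and has Rayleigh quotient at most [lamh k]. The Rayleigh
    quotient then has a minimiser on the orthogonal of these [k]
    eigenfunctions, and the minimiser is an eigenfunction for an eigenvalue
    below [lam k] ([eigenvector_minimizer]); its eigenspace is spanned by some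
    of the first [k] eigenfunctions, to which it is orthogonal: a
    contradiction.

    The existence of the minimiser uses two facts. H^1_0 is complete
    ([H10_complete], from the Riesz-Fischer theorem [sqint_complete]), and it
    is compactly embedded in L^2 in the following quantitative sense
    ([H10_compact]): for every [e], the squared L2 norm is at most [e] times
    the energy plus finitely many squares of bounded functionals. The
    functionals are averages over the cells of a fine grid, and the estimate is
    the Poincare inequality on a small cube ([box_poincare]) for test
    functions, extended by zero, followed by a passage to the closure. *)

(** * Bilinear forms *)

Lemma quadratic_ge0_discriminant {R : realFieldType} (a b c : R) :
  (forall t, 0 <= t ^+ 2 * a + t * b *+ 2 + c) -> b ^+ 2 <= a * c.
Proof.
move=> h; have [a0|a0] := ltP 0 a.
  have := h (- b / a).
  rewrite (_ : _ + _ = (a * c - b ^+ 2) / a).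
    by rewrite pmulr_lge0 ?invr_gt0// subr_ge0.
  by rewrite mulr2n; field; rewrite gt_eqF.
have b0 : b = 0.
  apply/eqP/negP => /negP n0.
  have := h (- (c + 1) / (2 * b)); set t := _ / _.
  have -> : t * b *+ 2 = - (c + 1) by rewrite /t mulr2n; field; rewrite n0.
  have : t ^+ 2 * a <= 0 by rewrite mulr_ge0_le0// sqr_ge0.
  by move=> ? ?; lra.
have c0 : 0 <= c by have := h 0; rewrite expr0n/= !mul0r mul0rn !add0r.
have [a1|a1] := ltP a 0; last first.
  by rewrite (_ : a = 0) ?b0 ?expr0n/= ?mul0r//; apply/eqP; rewrite eq_le a0.
have := h ((c + 1) / (- a) + 1); rewrite b0 mulr0 mul0rn addr0.
set u := _ / _; have u0 : 0 <= u by rewrite divr_ge0//; lra.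
have e : u * a = - (c + 1) by rewrite /u; field; lra.
rewrite (_ : _ * _ = u * (u * a) + 2 * (u * a) + a); last by ring.
by rewrite e; nra.
Qed.

Lemma le0_of_small {R : realFieldType} (a b : R) :
  (forall e, 0 < e -> e <= 1 -> a <= e * b) -> a <= 0.
Proof.
move=> h; rewrite leNgt; apply/negP => a0.
have b0 : 0 < b by have := h 1 ltr01 (lexx _); lra.
have := h (Num.min 1 (a / (2 * b))).
rewrite lt_min ltr01 divr_gt0//= ?mulr_gt0// ge_min lexx => /(_ isT isT).
rewrite leNgt => /negP; apply.
apply: (@le_lt_trans _ _ (a / (2 * b) * b)).
  by rewrite ler_wpM2r ?ge_min ?lexx ?orbT// ltW.
by rewrite (_ : _ * b = a / 2) ?ltr_pdivrMr//; [lra|field; lra].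
Qed.

Lemma eq0_of_small_sqr {R : realFieldType} (a b : R) :
  (forall e, 0 < e -> e <= 1 -> a ^+ 2 <= e * b) -> a = 0.
Proof.
by move=> /le0_of_small a0; apply/eqP; rewrite -sqrf_eq0 eq_le a0 sqr_ge0.
Qed.

Section forms.
Context {R : realType} {X : lmodType R}.
Implicit Types (B : X -> X -> R) (x y z : X).

Definition sym_bilinear B :=
  (forall x y, B x y = B y x) /\
  (forall a x y z, B (a *: x + y) z = a * B x z + B y z).

Definition psd_form B := sym_bilinear B /\ forall x, 0 <= B x x.

Section bilinear.
Context (B : X -> X -> R) (hB : sym_bilinear B).

Lemma formC x y : B x y = B y x. Proof. exact: hB.1. Qed.
Lemma formDl x y z : B (x + y) z = B x z + B y z.
Proof. by rewrite -[x in LHS]scale1r hB.2 mul1r. Qed.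
Lemma form0l z : B 0 z = 0.
Proof. by apply: (addrI (B 0 z)); rewrite -formDl !addr0. Qed.
Lemma formZl a x z : B (a *: x) z = a * B x z.
Proof. by rewrite -[a *: x]addr0 hB.2 form0l addr0. Qed.
Lemma formDr x y z : B z (x + y) = B z x + B z y.
Proof. by rewrite formC formDl !(formC z). Qed.
Lemma formZr a x z : B z (a *: x) = a * B z x.
Proof. by rewrite formC formZl (formC z). Qed.
Lemma formNl x z : B (- x) z = - B x z.
Proof. by rewrite -scaleN1r formZl mulN1r. Qed.
Lemma formNr x z : B z (- x) = - B z x.
Proof. by rewrite formC formNl (formC z). Qed.
Lemma form_suml I (s : seq I) (P : pred I) (F : I -> X) z :
  B (\sum_(i <- s | P i) F i) z = \sum_(i <- s | P i) B (F i) z.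
Proof.
by apply: (big_morph (fun x => B x z)) => [x y|]; rewrite (formDl, form0l).
Qed.
Lemma form_sumr I (s : seq I) (P : pred I) (F : I -> X) z :
  B z (\sum_(i <- s | P i) F i) = \sum_(i <- s | P i) B z (F i).
Proof. by rewrite formC form_suml; apply: eq_bigr => i _; rewrite formC. Qed.
Lemma form_sqrD x y : B (x + y) (x + y) = B x x + B x y *+ 2 + B y y.
Proof. by rewrite formDl !formDr (formC y x) mulr2n; ring. Qed.
Lemma form_sqrB x y : B (x - y) (x - y) = B x x - B x y *+ 2 + B y y.
Proof. by rewrite form_sqrD formNr formNl formNr mulr2n; ring. Qed.
Lemma form_sqrZ a x : B (a *: x) (a *: x) = a ^+ 2 * B x x.
Proof. by rewrite formZl formZr mulrA. Qed.
End bilinear.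

(** A form which is only known to be nonnegative on the line through two
    vectors: the energy minus a multiple of the L2 product is nonnegative on a
    subspace only. *)
Lemma form_cauchy_schwarz_line B x y : sym_bilinear B ->
  (forall t : R, 0 <= B (t *: x + y) (t *: x + y)) ->
  B x y ^+ 2 <= B x x * B y y.
Proof.
move=> hB h; apply: quadratic_ge0_discriminant => t.
by have := h t; rewrite form_sqrD// form_sqrZ// formZl.
Qed.

Lemma form_cauchy_schwarz B x y : psd_form B ->
  B x y ^+ 2 <= B x x * B y y.
Proof. by move=> [hB B0]; exact: form_cauchy_schwarz_line. Qed.

Lemma form_isotropic B x y : psd_form B -> B x x = 0 -> B x y = 0.
Proof.
move=> hB x0; apply/eqP; rewrite -sqrf_eq0 eq_le sqr_ge0 andbT.
by rewrite -[leRHS](mul0r (B y y)) -x0 form_cauchy_schwarz.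
Qed.

Lemma form_sqrD_le B x y : psd_form B ->
  B (x + y) (x + y) <= 2 * B x x + 2 * B y y.
Proof.
move=> [hB B0]; have := B0 (x - y); rewrite form_sqrB// form_sqrD// !mulr2n.
lra.
Qed.

Lemma form_sqrB_le B x y : psd_form B ->
  B (x - y) (x - y) <= 2 * B x x + 2 * B y y.
Proof.
move=> hB; have := form_sqrD_le x (- y) hB.
by rewrite (formNl hB.1) (formNr hB.1) opprK.
Qed.

(** Gram-Schmidt without independence: when a vector of the family has an
    isotropic residue, that residue is orthogonal to everything and nothing has
    to be subtracted along it. *)
Lemma orthogonal_projection B (E : seq X) (q : X) : psd_form B ->
  exists c : nat -> R, forall e, e \in E ->
    B (q - \sum_(i < size E) c i *: E`_i) e = 0.
Proof.
move=> hB; have [hS B0] := hB.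
elim: E q => [|e E IH] q; first by exists (fun=> 0).
have [c hc] := IH q; have [b hb] := IH e.
pose q' := q - \sum_(i < size E) c i *: E`_i.
pose e' := e - \sum_(i < size E) b i *: E`_i.
pose t := B q' e' / B e' e'.
exists (fun i => if i is j.+1 then c j - t * b j else t) => f.
have -> : q - \sum_(i < size (e :: E))
      (match i : nat with 0%N => t | j.+1 => c j - t * b j end) *: (e :: E)`_i
    = q' - t *: e'.
  rewrite big_ord_recl /=.
  rewrite (eq_bigr (fun i : 'I_(size E) => c i *: E`_i - t *: (b i *: E`_i))).
    rewrite sumrB -scaler_sumr /q' /e' scalerBr opprD !opprB -addrA.
    by congr (_ + _); rewrite addrC addrAC addrC.
  by move=> i _; rewrite scalerBl scalerA.
have ee' : B (q' - t *: e') e' = 0.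
  rewrite formDl// formNl// formZl// /t.
  have [n0|n0] := eqVneq (B e' e') 0; last by rewrite divfK ?subrr.
  by rewrite n0 mulr0 subr0 formC// form_isotropic.
have hE g : g \in E -> B (q' - t *: e') g = 0.
  by move=> gE; rewrite formDl// formNl// formZl// hc// hb// mulr0 subr0.
rewrite inE => /orP[/eqP ->|]; last exact: hE.
have -> : e = e' + \sum_(i < size E) b i *: E`_i by rewrite subrK.
rewrite formDr// ee' add0r form_sumr// big1// => i _.
by rewrite formZr// hE ?mulr0// mem_nth.
Qed.

(** * Eigenvectors of a pair of forms *)

(** [L] stands for the L2 product and [D] for the energy. *)
Definition form_complete (L D : X -> X -> R) := forall u : nat -> X,
  (forall e : R, 0 < e -> exists k, forall i j, (k <= i)%N -> (k <= j)%N ->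
     L (u i - u j) (u i - u j) + D (u i - u j) (u i - u j) < e) ->
  exists v, forall e : R, 0 < e -> exists k, forall i, (k <= i)%N ->
     L (u i - v) (u i - v) + D (u i - v) (u i - v) < e.

(** Relative to [D], the form [L] is arbitrarily small up to finitely many
    bounded functionals; this encodes the compactness of the embedding of the
    space normed by [L + D] into the space normed by [L]. *)
Definition form_compact (L D : X -> X -> R) := forall e : R, 0 < e ->
  exists (n : nat) (phi : 'I_n -> X -> R),
    [/\ forall i x y, phi i (x - y) = phi i x - phi i y,
        forall i, exists C, forall x, phi i x ^+ 2 <= C * L x x &
        forall x, L x x <= e * D x x + \sum_(i < n) phi i x ^+ 2].

(** A bounded function converges along an ultrafilter, segments being
    compact. *)
Lemma ultra_bounded_cauchy (U : set_system X) (f : X -> R) (C e : R) :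
  UltraFilter U -> U [set x | `|f x| <= C] -> 0 < e ->
  exists2 A, U A & forall x y, A x -> A y -> (f x - f y) ^+ 2 <= e.
Proof.
move=> UU UC e0.
have := @segment_compact R (- C) C; rewrite compact_ultra.
have FU : UltraFilter (f @ U).
  split=> [|G GG fUG]; first exact: fmap_proper_filter.
  apply/seteqP; split=> // A GA.
  have [//|UA] := in_ultra_setVsetC (f @^-1` A) UU.
  have /fUG GA' : (f @ U) (~` A) by [].
  have : G (A `&` ~` A) by exact: filterI.
  by rewrite setICr => G0; have := @filter_not_empty _ G GG.
move=> /(_ (f @ U) FU) [|l [_ fl]].
  rewrite nbhs_simpl /=; move: UC; apply: filterS => x.
  by rewrite /= in_itv/= -ler_norml.
pose r := Num.min 1 (e / 4); have r0 : 0 < r by rewrite lt_min ltr01/=; lra.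
exists [set x | `|l - f x| < r].
  by move/cvgrPdist_lt : fl => /(_ r r0).
move=> x y /= xr yr.
have r1 : r <= 1 by rewrite ge_min lexx.
have r2 : r <= e / 4 by rewrite ge_min lexx orbT.
by move: xr yr; rewrite !ltr_norml => /andP[? ?] /andP[? ?]; nra.
Qed.

Section minimizer.
Context (L D : X -> X -> R) (E : seq X).
Hypotheses (hL : psd_form L) (hD : psd_form D).
Hypothesis hE : forall e, e \in E -> exists l, forall q, D e q = l * L e q.

Let S := [set x | forall e, e \in E -> L x e = 0].

Let SD x y : S x -> S y -> S (x + y).
Proof. by move=> Sx Sy e eE; rewrite (formDl hL.1) Sx// Sy// addr0. Qed.

Let SZ a x : S x -> S (a *: x).
Proof. by move=> Sx e eE; rewrite (formZl hL.1) Sx// mulr0. Qed.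

Let Rayleigh := [set D x x | x in [set x | S x /\ L x x = 1]].
Let m := inf Rayleigh.

Hypothesis Rayleigh0 : Rayleigh !=set0.

Let Rayleigh_lbound : has_lbound Rayleigh.
Proof. by exists 0 => _ [x _ <-]; exact: hD.2. Qed.

Let m_ge0 : 0 <= m.
Proof. by apply: lb_le_inf => // _ [x _ <-]; exact: hD.2. Qed.

Let m_le x : S x -> m * L x x <= D x x.
Proof.
move=> Sx; have := hL.2 x; rewrite le_eqVlt => /orP[/eqP <-|x0].
  by rewrite mulr0; exact: hD.2.
have n0 : Num.sqrt (L x x) != 0 by rewrite gt_eqF// sqrtr_gt0.
have : m <= D ((Num.sqrt (L x x))^-1 *: x) ((Num.sqrt (L x x))^-1 *: x).
  apply: ge_inf => //; exists ((Num.sqrt (L x x))^-1 *: x) => //; split.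
    exact: SZ.
  by rewrite (form_sqrZ hL.1) exprVn sqr_sqrtr ?mulVf ?gt_eqF// ltW.
rewrite (form_sqrZ hD.1) exprVn sqr_sqrtr ?(ltW x0)//.
by rewrite [_^-1 * _]mulrC ler_pdivlMr.
Qed.

(* A vector at which the infimum is attained is isotropic for the form
   [D - m L], which is nonnegative on [S]. *)
Let minimizer_eigenvector v : S v -> L v v = 1 -> D v v = m ->
  forall q, D v q = m * L v q.
Proof.
move=> Sv Lv Dv.
pose B x y := D x y - m * L x y.
have hB : sym_bilinear B.
  split=> [x y|a x y z]; rewrite /B; first by rewrite (formC hD.1) (formC hL.1).
  by rewrite (hL.1).2 (hD.1).2; ring.
have hq q : S q -> B v q = 0.
  move=> Sq; apply/eqP; rewrite -sqrf_eq0 eq_le sqr_ge0 andbT.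
  rewrite (le_trans (form_cauchy_schwarz_line hB _))//.
    by move=> t; rewrite subr_ge0 m_le//; apply: SD => //; exact: SZ.
  by rewrite {1}/B Lv Dv mulr1 subrr mul0r.
move=> q; have [c hc] := orthogonal_projection E q hL.
apply/eqP; rewrite -subr_eq0 -[_ - _]/(B v q).
rewrite -(subrK (\sum_(i < size E) c i *: E`_i) q) (formDr hB) hq// add0r.
rewrite (form_sumr hB) big1// => i _; rewrite (formZr hB).
have EiE : E`_i \in E by rewrite mem_nth.
have [l hl] := hE EiE.
by rewrite /B (formC hD.1) hl (formC hL.1) Sv// !mulr0 subr0 mulr0.
Qed.

Hypotheses (LDcomplete : form_complete L D) (LDcompact : form_compact L D).

Let low k := [set x | [/\ S x, L x x = 1 & D x x < m + k.+1%:R^-1]].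

Let low_neq0 k : low k !=set0.
Proof.
have : has_inf Rayleigh by split.
move=> /inf_adherent -/(_ k.+1%:R^-1 _)[|_ [x [Sx x1] <-] xm].
  by rewrite invr_gt0.
by exists x.
Qed.

(* An ultrafilter finer than the minimising sequences replaces the extraction
   of subsequences: bounded functionals converge along it. *)
Let minimizing_cauchy : exists2 U : set_system X, UltraFilter U &
  (forall k, U (low k)) /\
  forall e : R, 0 < e -> exists2 A, U A & forall x y, A x -> A y ->
    L (x - y) (x - y) + D (x - y) (x - y) < e.
Proof.
pose F := filter_from setT low.
have FF : ProperFilter F.
  apply: filter_from_proper; last by move=> k _; exact: low_neq0.
  apply: filter_from_filter; first by exists 0%N.
  move=> i j _ _; exists (maxn i j) => // x [Sx x1 xm].
  split; split => //; apply: (lt_le_trans xm); rewrite lerD2l lef_pV2 ?posrE//.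
    by rewrite ler_nat ltnS leq_maxl.
  by rewrite ler_nat ltnS leq_maxr.
have [U [UU FU]] := ultraFilterLemma FF.
exists U => //.
have Ulow k : U (low k) by apply: FU; exists k.
split=> // e e0.
have hm := m_ge0.
(* [e1] and [e2] make [(m + 1) * L (x - y) (x - y)] smaller than [e / 2],
   because [D x x] and [D y y] are less than [m + 1] *)
pose e1 := e / (16 * (m + 1) * (m + 1)).
have e10 : 0 < e1 by rewrite divr_gt0// !mulr_gt0//; lra.
have [n [phi [phiB phiC phiL]]] := LDcompact e10.
pose e2 := e / (8 * (m + 1) * n.+1%:R).
have e20 : 0 < e2 by rewrite divr_gt0// !mulr_gt0//; lra.
have : forall i, exists A, U A /\
    forall x y, A x -> A y -> (phi i x - phi i y) ^+ 2 <= e2.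
  move=> i; have [C hC] := phiC i.
  have [|A ? ?] := @ultra_bounded_cauchy U (phi i) (Num.sqrt C) e2 UU _ e20;
    last by exists A.
  apply: filterS (Ulow 0%N) => x /= [_ x1 _].
  by have := hC x; rewrite x1 mulr1 -sqrtr_sqr; exact: ler_wsqrtr.
move=> /choice [A hA].
have [k hk] : exists k : nat, k.+1%:R^-1 <= e / 16.
  have [|k] := @ltr_add_invr R 0 (e / 16); first lra.
  by rewrite add0r => /ltW; exists k.
exists (low 0 `&` low k `&` [set x | forall i, A i x]).
  apply: filterI; first exact: filterI.
  by apply: filter_forall => i; have [] := hA i.
move=> x y [[[Sx x1 xm] [_ _ xk]] xA] [[[Sy y1 ym] [_ _ yk]] yA].
have DB := form_sqrB_le x y hD.
have Lxy : L (x - y) (x - y) <= e1 * (4 * (m + 1)) + n%:R * e2.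
  apply: le_trans (phiL _) _; apply: lerD.
    by rewrite ler_wpM2l ?(ltW e10)//; move: xm ym; rewrite invr1; lra.
  rewrite (_ : n%:R * e2 = \sum_(i < n) e2).
    by apply: ler_sum => i _; rewrite phiB; apply: (hA i).2; [exact: xA|exact: yA].
  by rewrite sumr_const card_ord mulr_natl.
have Lxy1 : (m + 1) * L (x - y) (x - y) < e / 2.
  have : (m + 1) * (e1 * (4 * (m + 1)) + n%:R * e2) < e / 2.
    have -> : (m + 1) * (e1 * (4 * (m + 1)) + n%:R * e2) =
        e / 4 + e / 8 * (n%:R / n.+1%:R).
      rewrite /e1 /e2; have := ltr0Sn R n; move: n.+1%:R n%:R => a b a0.
      by field; apply/andP; split; rewrite gt_eqF//; lra.
    have : n%:R / n.+1%:R <= 1 :> R by rewrite ler_pdivrMr// mul1r ler_nat.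
    move=> /(ler_piMr (_ : 0 <= e / 8)) => h; have {}h := h ltac:(lra).
    by move: (e / 8 * _) h => q h; lra.
  by apply: le_lt_trans; rewrite ler_wpM2l//; lra.
(* parallelogram identity: [D (x + y) (x + y)] is bounded from below *)
have := m_le (SD Sx Sy).
rewrite (form_sqrD hL.1) (form_sqrD hD.1).
move: Lxy1; rewrite (form_sqrB hL.1) (form_sqrB hD.1) x1 y1 !mulr2n.
move: k.+1%:R^-1 xk yk hk => z; rewrite mulrDl mul1r !(mulrBr, mulrDr).
move: (m * L x y) => t; rewrite -[(1 + 1)%R]/(2%:R).
by lra.
Qed.

(** The direct method. Vectors of low energy are close in [L] by compactness,
    and then close in [D] by the parallelogram identity, so completeness yields
    a minimiser. It is isotropic for [D - m L], hence an eigenvector against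
    [S]; projecting onto the eigenvectors in [E] extends this to all test
    vectors. *)
Lemma eigenvector_minimizer : exists (l : R) (v : X),
  [/\ forall x, S x -> l * L x x <= D x x, L v v = 1, S v &
      forall q, D v q = l * L v q].
Proof.
have [U UU [Ulow Ucauchy]] := minimizing_cauchy.
have : forall k : nat, exists A, U A /\ forall x y, A x -> A y ->
    L (x - y) (x - y) + D (x - y) (x - y) < k.+1%:R^-1.
  by move=> k; have [|A ? ?] := Ucauchy k.+1%:R^-1; [rewrite invr_gt0|exists A].
move=> /choice[A hA].
have : forall k : nat, exists x, low k x /\ forall i : 'I_k.+1, A i x.
  move=> k; have : U (low k `&` [set x | forall i : 'I_k.+1, A i x]).
    by apply: filterI => //; apply: filter_forall => i; have [] := hA i.
  by move=> /filter_ex [x [? xA]]; exists x; split => // i; exact: xA.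
move=> /choice[u hu].
have inv_lt (e : R) : 0 < e -> exists k, forall i, (k <= i)%N -> i.+1%:R^-1 < e.
  move=> e0; have [k ke] := ltr_add_invr e0.
  exists k => i ki; rewrite add0r in ke; apply: le_lt_trans ke.
  by rewrite lef_pV2 ?posrE// ler_nat.
have hm := m_ge0.
have [|v hv] := LDcomplete (u := u).
  move=> e /inv_lt[k hk]; exists k => i j ki kj; apply: lt_trans (hk k (leqnn k)).
  rewrite -ltnS in ki; rewrite -ltnS in kj.
  by apply: (hA k).2; [exact: (hu i).2 (Ordinal ki)|exact: (hu j).2 (Ordinal kj)].
(* every estimate below is evaluated at one far term of the sequence *)
have near_v (e : R) : 0 < e -> exists x r, [/\ v = x - r, S x, L x x = 1,
    D x x < m + e /\ D x x <= m + 1 & L r r <= e /\ D r r <= e].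
  move=> e0; have [k1 hk1] := hv e e0; have [k2 hk2] := inv_lt e e0.
  pose i := maxn k1 k2; exists (u i), (u i - v).
  have [[Su Lu Du] _] := hu i.
  have := hk1 i (leq_maxl _ _); have := hk2 i (leq_maxr _ _).
  have := hL.2 (u i - v); have := hD.2 (u i - v) => D0 L0 ie uve.
  split=> //; [by rewrite subKr| |by split; lra].
  split; first by apply: lt_trans Du _; rewrite ltrD2l.
  by apply: le_trans (ltW Du) _; rewrite lerD2l invf_le1// ler1n.
have Sv : S v.
  move=> f fE; apply: (@eq0_of_small_sqr R _ (L f f)) => e e0 _.
  have [x [r [-> Sx _ _ [re _]]]] := near_v e e0.
  rewrite (formDl hL.1) (formNl hL.1) Sx// sub0r sqrrN.
  by apply: le_trans (form_cauchy_schwarz _ _ hL) _; rewrite ler_wpM2r// hL.2.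
have Lv : L v v = 1.
  apply/subr0_eq; apply: (@eq0_of_small_sqr R _ 10) => e e0 e1.
  have [x [r [-> Sx x1 _ [re _]]]] := near_v e e0.
  have := form_cauchy_schwarz x r hL; rewrite (form_sqrB hL.1) x1 mul1r mulr2n.
  have := hL.2 r; move: (L r r) (L x r) re => s t se s0 ts.
  have := sqr_ge0 (s + 2 * t).
  have : 0 <= s * (1 - s) by rewrite mulr_ge0//; lra.
  by nra.
exists m, v; split=> //.
apply: minimizer_eigenvector => //.
apply/subr0_eq; apply: (@eq0_of_small_sqr R _ (8 + 8 * (m + 1))) => e e0 e1.
have := m_le Sv; rewrite Lv mulr1.
have [x [r [-> Sx _ [xe xm] [_ re]]]] := near_v e e0.
have := form_cauchy_schwarz x r hD; rewrite (form_sqrB hD.1) mulr2n.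
have := hD.2 r; have := hD.2 x.
move: (D r r) (D x r) (D x x) re xe xm => s t w re xe xm w0 s0 ts h.
have t2 : t ^+ 2 <= (m + 1) * e by nra.
have h1 : w - (t + t) + s - m <= 2 * e + 2 * `|t|.
  by have := ler_norm (- t); rewrite normrN; lra.
have t3 : `|t| ^+ 2 <= (m + 1) * e by rewrite real_normK// num_real.
have := normr_ge0 t; move: `|t| h1 t3 => t' h1 t3 t'0.
have : (w - (t + t) + s - m) ^+ 2 <= (2 * e + 2 * t') ^+ 2.
  by rewrite ler_sqr ?nnegrE//; lra.
move=> /le_trans; apply.
have := sqr_ge0 (e - t').
have : 0 <= e * (1 - e) by rewrite mulr_ge0//; lra.
by nra.
Qed.
End minimizer.
End forms.

(** * Square-integrable functions *)

Section lower_integral.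
Local Open Scope ereal_scope.

(** The integral of a nonnegative function is a supremum over the simple
    functions below it, which is monotone for arbitrary functions. *)
Lemma ge0_le_lower_integral dd (T : measurableType dd) (R : realType)
    (m : {measure set T -> \bar R}) (D : set T) (f1 f2 : T -> \bar R) :
  (forall x, D x -> 0 <= f1 x) -> (forall x, D x -> f1 x <= f2 x) ->
  \int[m]_(x in D) f1 x <= \int[m]_(x in D) f2 x.
Proof.
move=> f10 f12.
have f20 x : D x -> 0 <= f2 x by move=> Dx; exact: le_trans (f10 x Dx) (f12 x Dx).
rewrite !(integral_mkcond D) !ge0_integralTE; try exact: erestrict_ge0.
apply: le_ereal_sup => _ [h hf <-]; exists h => // x.
by apply: le_trans (hf x) _; exact: lee_restrict.
Qed.

End lower_integral.

Section sqint.
Context {dd : measure_display} {T : measurableType dd} {R : realType}.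
Context (mu : {measure set T -> \bar R}) (D : set T) (mD : measurable D).
Implicit Types f g h : T -> R.

Definition sqint f :=
  measurable_fun D f /\ (\int[mu]_(x in D) (f x ^+ 2)%:E < +oo)%E.

Definition ip f g : R := \int[mu]_(x in D) (f x * g x).

Lemma sqint_mul_integrable f g : sqint f -> sqint g ->
  mu.-integrable D (fun x => (f x * g x)%:E).
Proof.
move=> [mf f2] [mg g2].
have m2 h : measurable_fun D h ->
    measurable_fun D (fun x => (h x ^+ 2)%:E : \bar R).
  by move=> mh; apply/measurable_EFinP; exact: measurable_funX.
have i2 h : measurable_fun D h -> (\int[mu]_(x in D) (h x ^+ 2)%:E < +oo)%E ->
    mu.-integrable D (fun x => (h x ^+ 2)%:E).
  move=> mh h2; apply/integrableP; split; first exact: m2.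
  by under eq_integral do rewrite gee0_abs ?lee_fin ?sqr_ge0//.
apply: (le_integrable mD _ _ (integrableD mD (i2 _ mf f2) (i2 _ mg g2))).
  by apply/measurable_EFinP; exact: measurable_funM.
move=> x Dx; rewrite /= lee_fin [leRHS]ger0_norm ?addr_ge0 ?sqr_ge0//.
have := sqr_ge0 (f x - g x); have := sqr_ge0 (f x + g x).
by rewrite ler_norml => ? ?; apply/andP; split; nra.
Qed.

Lemma sqint_integrable f : sqint f -> mu.-integrable D (fun x => (f x ^+ 2)%:E).
Proof. exact: (fun hf => sqint_mul_integrable hf hf). Qed.

Lemma sqint_lin a f g : sqint f -> sqint g -> sqint (fun x => a * f x + g x).
Proof.
move=> hf hg; have [mf _] := hf; have [mg _] := hg.
have mfg : measurable_fun D (fun x => a * f x + g x).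
  by apply: measurable_funD => //; exact: measurable_funM.
split => //.
have := integrableD mD (integrableZl mD (2 * a ^+ 2) (sqint_integrable hf))
  (integrableZl mD 2 (sqint_integrable hg)).
move=> /integrableP[m2 i2]; apply: le_lt_trans i2.
apply: ge0_le_integral => //.
- by move=> x _; rewrite lee_fin sqr_ge0.
- by apply/measurable_EFinP; exact: measurable_funX.
- exact: measurableT_comp.
move=> x _ /=; rewrite lee_fin ger0_norm.
  by have := sqr_ge0 (a * f x - g x); nra.
by have := sqr_ge0 (a * f x); have := sqr_ge0 (g x); nra.
Qed.

Lemma sqint0 : sqint (fun=> 0).
Proof.
split; first exact: measurable_cst.
by under eq_integral do rewrite expr0n/=; rewrite integral0.
Qed.

Lemma ipC f g : ip f g = ip g f.
Proof. by apply: eq_Rintegral => x _; rewrite mulrC. Qed.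

Lemma ip_lin a f g h : sqint f -> sqint g -> sqint h ->
  ip (fun x => a * f x + g x) h = a * ip f h + ip g h.
Proof.
move=> hf hg hh; rewrite /ip -RintegralZl//; last exact: sqint_mul_integrable.
rewrite -RintegralD//; last 2 first.
- exact: integrableZl (sqint_mul_integrable hf hh).
- exact: sqint_mul_integrable.
by apply: eq_Rintegral => x _; rewrite mulrDl mulrA.
Qed.

Lemma ipBl f g h : sqint f -> sqint g -> sqint h ->
  ip (fun x => f x - g x) h = ip f h - ip g h.
Proof.
move=> hf hg hh; rewrite -mulN1r addrC -ip_lin//.
by apply: eq_Rintegral => x _; rewrite mulN1r [- _ + _]addrC.
Qed.

Lemma ip_ge0 f : 0 <= ip f f.
Proof. by apply: Rintegral_ge0 => x _; rewrite -expr2 sqr_ge0. Qed.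

Lemma ipE f : sqint f -> (ip f f)%:E = (\int[mu]_(x in D) (f x ^+ 2)%:E)%E.
Proof.
move=> hf; rewrite /ip /Rintegral fineK//.
exact: (integrable_fin_num mD (sqint_integrable hf)).
Qed.

Lemma ip_cauchy_schwarz f g : sqint f -> sqint g ->
  ip f g ^+ 2 <= ip f f * ip g g.
Proof.
move=> hf hg; apply: quadratic_ge0_discriminant => t.
have h := sqint_lin t hf hg.
have := ip_ge0 (fun x => t * f x + g x).
rewrite ip_lin// (ipC f) (ipC g) !ip_lin// (ipC g f); congr (_ <= _).
by rewrite mulr2n; ring.
Qed.

Lemma sqintB f g : sqint f -> sqint g -> sqint (fun x => f x - g x).
Proof.
move=> hf hg; have := sqint_lin (-1) hg hf; congr sqint.
by apply/funext => x; rewrite mulN1r addrC.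
Qed.

(** Riesz-Fischer. Along a fast subsequence the increments [h_k] satisfy
    [|h_k| <= 4^k h_k^2 + 4^-k], and the right-hand side has a finite integral;
    the pointwise limit is compared with the sequence by Fatou's lemma. *)
Lemma sqint_complete (f : nat -> T -> R) : (forall n, sqint (f n)) ->
  (forall e : R, 0 < e -> exists k, forall i j, (k <= i)%N -> (k <= j)%N ->
     ip (fun x => f i x - f j x) (fun x => f i x - f j x) < e) ->
  exists2 g, sqint g & forall e : R, 0 < e -> exists k, forall i, (k <= i)%N ->
     ip (fun x => f i x - g x) (fun x => f i x - g x) < e.
Proof.
move=> hf cf.
have : forall k : nat, exists N, forall i j, (N <= i)%N -> (N <= j)%N ->
    ip (fun x => f i x - f j x) (fun x => f i x - f j x) < 8^-1 ^+ k.
  by move=> k; apply: cf; rewrite exprn_gt0.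
move=> /choice[N hN].
pose M k := (\max_(l < k.+1) N l + k)%N.
have NM k l : (k <= l)%N -> (N k <= M l)%N.
  move=> kl; rewrite -ltnS in kl.
  exact/(leq_trans _ (leq_addr _ _))/(leq_bigmax (Ordinal kl)).
pose F k := f (M k).
have mF k : measurable_fun D (F k) by exact: (hf _).1.
pose h k x := F k.+1 x - F k x.
have hh k : sqint (h k) by exact: (sqintB (hf _) (hf _)).
pose u k x := 4 ^+ k * h k x ^+ 2.
have u0 k x : 0 <= u k x by rewrite mulr_ge0 ?sqr_ge0 ?exprn_ge0.
have mu_ k : measurable_fun D (u k).
  by apply: measurable_funM => //; apply: measurable_funX; exact: (hh k).1.
have intu k : (\int[mu]_(x in D) (u k x)%:E <= (2^-1 ^+ k)%:E)%E.
  under eq_integral do rewrite EFinM.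
  rewrite ge0_integralZl_EFin ?exprn_ge0//; last 2 first.
  - by move=> x _; rewrite lee_fin sqr_ge0.
  - by apply/measurable_EFinP; apply: measurable_funX; exact: (hh k).1.
  rewrite -ipE// -EFinM lee_fin.
  have -> : 2^-1 ^+ k = 4 ^+ k * 8^-1 ^+ k :> R.
    by rewrite -exprMn; congr (_ ^+ _); field.
  by rewrite ler_wpM2l ?exprn_ge0// ltW// hN// ?NM.
have Su : (\int[mu]_(x in D) (\sum_(0 <= k <oo) (u k x)%:E) < +oo)%E.
  rewrite integral_nneseries//; last 2 first.
  - by move=> n; exact/measurable_EFinP/mu_.
  - by move=> n x _; rewrite lee_fin.
  apply: (@le_lt_trans _ _ 2%:E); last exact: ltry.
  apply: lime_le.
    by apply: is_cvg_nneseries => n _ _; apply: integral_ge0 => x _; rewrite lee_fin.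
  apply: nearW => n; apply: (@le_trans _ _ (2 - 2 * 2^-1 ^+ n)%:E); last first.
    have : 0 <= 2^-1 ^+ n :> R by rewrite exprn_ge0.
    by rewrite lee_fin; lra.
  elim: n => [|n IH]; first by rewrite big_nil expr0 mulr1 subrr.
  rewrite big_nat_recr//=; apply: le_trans (leeD IH (intu n)) _.
  by rewrite -EFinD lee_fin exprS; lra.
have mS : measurable_fun D (fun x => \sum_(0 <= k <oo) (u k x)%:E)%E.
  apply: ge0_emeasurable_sum => [k x _ _|k _]; first by rewrite lee_fin.
  exact/measurable_EFinP/mu_.
have ae_cvg : \forall x \ae mu, D x -> cvgn (F ^~ x : R^nat).
  have : mu.-integrable D (fun x => \sum_(0 <= k <oo) (u k x)%:E)%E.
    apply/integrableP; split=> //.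
    apply: le_lt_trans Su; apply: ge0_le_integral => //.
    - exact: measurableT_comp.
    - by move=> x Dx; rewrite gee0_abs//; apply: nneseries_ge0 => k _ _; rewrite lee_fin.
  move=> /(integrable_ae mD); apply: filterS => x /[apply] ux.
  have : cvgn (series (fun k => u k x)).
    apply: nnseries_is_cvg => // ; move: ux; rewrite fin_numE => /andP[_].
    by rewrite -ltey.
  move=> cu; have cg : cvgn (series (geometric 1 4^-1 : R^nat)).
    by apply: is_cvg_geometric_series; rewrite ger0_norm//; lra.
  have : cvgn [normed series (fun k => h k x)].
    apply: (series_le_cvg _ _ _ (is_cvg_seriesD cu cg)) => [k|k|k] //=.
      apply: addr_ge0; first exact: u0.
      by rewrite /geometric /= mul1r exprn_ge0// invr_ge0.
    rewrite -[leRHS]/(4 ^+ k * h k x ^+ 2 + 1 * 4^-1 ^+ k) mul1r.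
    have : 0 <= (4 ^+ k * `|h k x| - 1) ^+ 2 by exact: sqr_ge0.
    rewrite -[h k x ^+ 2]real_normK ?num_real// exprVn.
    have k0 : 0 < 4 ^+ k :> R by rewrite exprn_gt0.
    move: (4 ^+ k) k0 `|h k x| (normr_ge0 (h k x)) => a a0 b b0 ab.
    rewrite -(ler_pM2l a0) mulrDr divff ?gt_eqF//; nra.
  move=> /normed_cvg ch.
  have -> : (F ^~ x : R^nat) = (fun k => F 0%N x + series (fun k => h k x) k).
    by apply/funext => k; rewrite [LHS](eq_sum_telescope (F ^~ x)).
  by apply: is_cvgD => //; exact: is_cvg_cst.
pose g x := fine (limn_esup (fun k => (F k x)%:E)).
have mg : measurable_fun D g.
  apply: (measurableT_comp (@fine_measurable R setT measurableT)).
  by apply: measurable_fun_limn_esup => k; exact/measurable_EFinP.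
have ae_g : \forall x \ae mu, D x -> F k x @[k --> \oo] --> g x.
  apply: filterS ae_cvg => x /[apply] Fx; rewrite /g.
  have : (F k x)%:E @[k --> \oo] --> (limn (F ^~ x))%:E.
    by apply: cvg_EFin => //; exact: nearW.
  by move=> /cvg_limn_einf_sup[_ ->].
have sqg i (e : R) K : (forall j, (K <= j)%N ->
    ip (fun x => f i x - f j x) (fun x => f i x - f j x) <= e) ->
    (\int[mu]_(x in D) ((f i x - g x) ^+ 2)%:E <= e%:E)%E.
  move=> he; pose v k x := ((f i x - F k x) ^+ 2)%:E.
  have mv k : measurable_fun D (v k).
    apply/measurable_EFinP; apply: measurable_funX; apply: measurable_funB => //.
    exact: (hf _).1.
  have v0 k x : D x -> (0 <= v k x)%E by rewrite lee_fin sqr_ge0.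
  have mlim : measurable_fun D (fun x => limn_einf (v ^~ x)).
    apply: (measurableT_comp (@oppe_measurable R setT)).
    apply: measurable_fun_limn_esup => k.
    exact: (measurableT_comp (@oppe_measurable R setT)).
  apply: (@le_trans _ _ (\int[mu]_(x in D) limn_einf (v ^~ x))%E).
    have ae_v : \forall x \ae mu, D x -> limn_einf (v ^~ x) = ((f i x - g x) ^+ 2)%:E.
      apply: filterS ae_g => x /[apply] Fg.
      suff : v k x @[k --> \oo] --> ((f i x - g x) ^+ 2)%:E.
        by move=> /cvg_limn_einf_sup[-> _].
      apply: cvg_EFin; first exact: nearW.
      by apply: (@cvgM _ _ _ _ (fun k => f i x - F k x) (fun k => f i x - F k x));
        apply: cvgB => //; exact: cvg_cst.
    rewrite le_eqVlt; apply/orP; left; apply/eqP.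
    apply: ge0_ae_eq_integral => //.
    - apply/measurable_EFinP; apply: measurable_funX; apply: measurable_funB => //.
      exact: (hf _).1.
    - by move=> x _; rewrite lee_fin sqr_ge0.
    - move=> x Dx; rewrite limn_einf_lim; apply: lime_ge; first exact: is_cvg_einfs.
      by apply: nearW => n; apply: le_ereal_inf_tmp => _ [k _ <-]; exact: v0.
    - by apply: filterS ae_v => x /[apply] ->.
  apply: le_trans (fatou mu mD mv v0) _.
  rewrite limn_einf_lim; apply: lime_le; first exact: is_cvg_einfs.
  apply: nearW => n; apply: (@le_trans _ _ (\int[mu]_(x in D) v (maxn n K) x)%E).
    by apply: ereal_inf_lbound; exists (maxn n K) => //=; exact: leq_maxl.
  rewrite -ipE ?lee_fin//; last exact: (sqintB (hf _) (hf _)).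
  by apply: he; rewrite /M (leq_trans (leq_maxr n K))// leq_addl.
have sqfg i e K : (forall j, (K <= j)%N ->
    ip (fun x => f i x - f j x) (fun x => f i x - f j x) <= e) ->
    sqint (fun x => f i x - g x).
  move=> /sqg fg; split; last by apply: le_lt_trans fg _; exact: ltry.
  by apply: measurable_funB => //; exact: (hf _).1.
exists g.
  have [K hK] := cf 1 ltr01.
  have : sqint (fun x => f K x - g x).
    by apply: (sqfg K 1 K) => j Kj; exact/ltW/hK.
  move=> /(sqintB (hf K)); congr sqint; apply/funext => x /=; ring.
move=> e e0; have [|K hK] := cf (e / 2); first by rewrite divr_gt0.
exists K => i Ki.
have he j : (K <= j)%N ->
    ip (fun x => f i x - f j x) (fun x => f i x - f j x) <= e / 2.
  by move=> Kj; exact/ltW/hK.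
rewrite -lte_fin ipE; last exact: sqfg he.
by apply: le_lt_trans (sqg _ _ _ he) _; rewrite lte_fin ltr_pdivrMr//; lra.
Qed.

End sqint.

Section Rintegral_sum.
Context {dd : measure_display} {T : measurableType dd} {R : realType}.
Context (mu : {measure set T -> \bar R}) (D : set T) (mD : measurable D).

Lemma Rintegral_sum (I : Type) (s : seq I) (F : I -> T -> R) :
  (forall i, mu.-integrable D (EFin \o F i)) ->
  \int[mu]_(x in D) (\sum_(i <- s) F i x) = \sum_(i <- s) \int[mu]_(x in D) F i x.
Proof.
move=> iF; elim: s => [|i s IH].
  rewrite big_nil; under eq_Rintegral do rewrite big_nil.
  by rewrite /Rintegral integral0.
rewrite big_cons -IH -RintegralD//.
  by apply: eq_Rintegral => x _; rewrite big_cons.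
have := integrable_sum mD s (P := xpredT) (fun i _ => iF i).
congr (integrable mu D _); apply/funext => x /=.
by rewrite sumEFin.
Qed.

Lemma ip_lin_le (a : R) (f g : T -> R) : sqint mu D f -> sqint mu D g ->
  ip mu D (fun x => a * f x + g x) (fun x => a * f x + g x) <=
  2 * a ^+ 2 * ip mu D f f + 2 * ip mu D g g.
Proof.
move=> hf hg; have h1 := sqint_lin mD a hf hg; have h2 := sqint_lin mD (- a) hf hg.
have := ip_ge0 mu D (fun x => - a * f x + g x).
rewrite !(ip_lin mD)// ![ip _ _ f (fun x => _ + _)]ipC ![ip _ _ g (fun x => _ + _)]ipC.
rewrite !(ip_lin mD)// (ipC _ _ g f); nra.
Qed.

Lemma sqint_sum (I : Type) (s : seq I) (F : I -> T -> R) :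
  (forall i, sqint mu D (F i)) -> sqint mu D (fun x => \sum_(i <- s) F i x).
Proof.
move=> sF; elim: s => [|i s IH].
  by under eq_fun do rewrite big_nil; exact: sqint0.
have := sqint_lin mD 1 (sF i) IH; congr sqint; apply/funext => x.
by rewrite big_cons mul1r.
Qed.

Lemma ip_suml (I : Type) (s : seq I) (F : I -> T -> R) g :
  (forall i, sqint mu D (F i)) -> sqint mu D g ->
  ip mu D (fun x => \sum_(i <- s) F i x) g = \sum_(i <- s) ip mu D (F i) g.
Proof.
move=> sF sg; rewrite /ip -Rintegral_sum => [|i]; last exact: sqint_mul_integrable.
by apply: eq_Rintegral => x _; rewrite mulr_suml.
Qed.

End Rintegral_sum.


Section mean_oscillation.
Context {dd : measure_display} {T : measurableType dd} {R : realType}.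
Context (mu : {measure set T -> \bar R}) (D : set T) (mD : measurable D).
Hypothesis Dfin : (mu D < +oo)%E.

Lemma sqint_bounded (f : T -> R) (C : R) : measurable_fun D f ->
  (forall x, D x -> `|f x| <= C) -> sqint mu D f.
Proof.
move=> mf fC; split=> //.
apply: (@le_lt_trans _ _ (\int[mu]_(x in D) cst (C ^+ 2)%:E x)%E).
  apply: ge0_le_lower_integral => [x _|x Dx]; first by rewrite lee_fin sqr_ge0.
  have C0 : 0 <= C := le_trans (normr_ge0 _) (fC x Dx).
  by rewrite lee_fin -[leLHS]real_normK ?num_real// lerXn2r ?nnegrE// fC.
rewrite integral_cst//; apply: lte_mul_pinfty => //.
by rewrite lee_fin sqr_ge0.
Qed.

Lemma sqint1 : sqint mu D (fun=> 1).
Proof.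
by apply: (@sqint_bounded _ 1) => [|x _]; [exact: measurable_cst|rewrite normr1].
Qed.

Lemma ip11 : ip mu D (fun=> 1) (fun=> 1) = fine (mu D).
Proof. by rewrite /ip/= mulr1 Rintegral_cst// mul1r. Qed.

(** Variance identity: it converts a bound on the oscillation into a bound on
    the deviation from the mean. *)
Lemma mean_oscillationE (f : T -> R) : sqint mu D f ->
  (\int[mu]_(x in D) \int[mu]_(y in D) ((f x - f y) ^+ 2)%:E)%E =
  (2 * (fine (mu D) * ip mu D f f - ip mu D f (fun=> 1) ^+ 2))%:E.
Proof.
move=> hf; have h1 := sqint1.
set a := fine (mu D); set q := ip mu D f f; set m := ip mu D f (fun=> 1).
have inner x : (\int[mu]_(y in D) ((f x - f y) ^+ 2)%:E)%E =
    (a * (f x * f x) + ((- 2 * m) * (f x * 1) + q * (1 * 1)))%:E.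
  have hx : sqint mu D (fun y => - f x * 1 + f y) by exact: sqint_lin.
  transitivity (\int[mu]_(y in D) ((- f x * 1 + f y) ^+ 2)%:E)%E.
    by apply: eq_integral => y _; congr (_%:E); ring.
  rewrite -ipE// ip_lin// (ipC _ _ (fun=> 1)) (ipC _ _ f) !ip_lin// ip11.
  by rewrite (ipC _ _ (fun=> 1) f) -/a -/q -/m; congr (_%:E); ring.
under eq_integral do rewrite inner.
have i1 := sqint_mul_integrable mD hf hf.
have i2 := sqint_mul_integrable mD hf h1.
have i3 := sqint_mul_integrable mD h1 h1.
have e g : mu.-integrable D (EFin \o g) ->
    (\int[mu]_(x in D) (g x)%:E)%E = (\int[mu]_(x in D) g x)%R%:E.
  by move=> ig; rewrite /Rintegral fineK//; exact: integrable_fin_num ig.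
have z k g : mu.-integrable D (EFin \o g) ->
    mu.-integrable D (EFin \o (fun x => k * g x)).
  by move=> ig; exact: (integrableZl mD k ig).
have s g h : mu.-integrable D (EFin \o g) -> mu.-integrable D (EFin \o h) ->
    mu.-integrable D (EFin \o (fun x => g x + h x)).
  by move=> ig ih; exact: (integrableD mD ig ih).
have j2 := z (- 2 * m) _ i2. have j3 := z q _ i3.
rewrite e; last exact: s (z a _ i1) (s _ _ j2 j3).
rewrite (RintegralD mD (z a _ i1) (s _ _ j2 j3)) (RintegralD mD j2 j3).
rewrite (RintegralZl a mD i1) (RintegralZl _ mD i2) (RintegralZl _ mD i3).
rewrite -![(\int[mu]_(x in D) _)%R]/(ip mu D _ _) -/q -/m ip11.
by congr (_%:E); rewrite -/a; ring.
Qed.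

End mean_oscillation.

(** * Lebesgue measure on R^d *)

Section rV_measurability.
Context {R : realType} {d : nat}.

(** An open set is the union of the grid cells of rational size that it
    contains; these are countably many products of intervals. *)
Lemma open_measurable_rV (U : set 'rV[R]_d) : open U -> measurable U.
Proof.
move=> oU.
pose cell (p : nat * 'rV[int]_d) := [set x : 'rV[R]_d | forall i,
  ((p.2 0 i)%:~R <= x 0 i * p.1.+1%:R < (p.2 0 i)%:~R + 1)].
have mcell p : measurable (cell p).
  rewrite (_ : cell p = \bigcap_(i in [set: 'I_d])
      (fun x : 'rV[R]_d => x 0 i : measurableTypeR R) @^-1`
      ((fun t => t * p.1.+1%:R) @^-1` `[(p.2 0 i)%:~R, (p.2 0 i)%:~R + 1[)).
    apply: fin_bigcap_measurable => // i _.
    rewrite -[X in measurable X]setTI.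
    apply: measurable_coord => //; rewrite -[X in measurable X]setTI.
    by apply: measurable_funM => //; exact: measurable_itv.
  by apply/seteqP; split => x /= xp i; [move=> _ /=|];
    have := xp i; rewrite /= in_itv/=; [|exact].
rewrite (_ : U = \bigcup_p (if `[< cell p `<=` U >] then cell p else set0)).
  apply: countable_bigcupT_measurable => [|p]; first exact: countableP.
  by case: ifP.
apply/seteqP; split => [x Ux|x [p _]]; last by case: asboolP => // pU /pU.
have /nbhs_ballP[e /= e0 xeU] : nbhs x U by exact: open_nbhs_nbhs.
have [n] := @ltr_add_invr R 0 e e0; rewrite add0r => ne.
exists (n, \row_i Num.floor (x 0 i * n.+1%:R)) => //.
have cx : cell (n, \row_i Num.floor (x 0 i * n.+1%:R)) x.
  move=> i /=; rewrite mxE.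
  by have := floor_itv (x 0 i * n.+1%:R); rewrite intrD.
case: asboolP => // -[] y cy; apply: xeU; split=> // i j; rewrite ord1.
have := cx j; have := cy j; rewrite /= mxE => /andP[y1 y2] /andP[x1 x2].
rewrite /ball/= -(@ltr_pM2r _ n.+1%:R)// -{1}(@gtr0_norm _ n.+1%:R)// -normrM.
apply: (@lt_trans _ _ 1); last by rewrite -ltr_pdivrMr// mul1r.
by rewrite mulrBl ltr_norml; lra.
Qed.

Lemma continuous_measurable_rV (f : 'rV[R]_d -> R) :
  continuous f -> measurable_fun setT f.
Proof.
move=> cf; apply: (measurability _ (RGenOInfty.measurableE R)) => //.
move=> _ [_ [x ->] <-]; rewrite setTI; apply: open_measurable_rV.
by apply: open_comp => //= y _; exact: cf.
Qed.

End rV_measurability.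

Section partial_integral.
Context {d1 d2 : measure_display} {T1 : measurableType d1}.
Context {T2 : measurableType d2} {R : realType}.
Local Open Scope ereal_scope.

Lemma measurable_partial_integral (m : {sigma_finite_measure set T2 -> \bar R})
    (A : set T2) (h : T1 * T2 -> \bar R) : measurable A ->
  measurable_fun setT h -> (forall p, 0 <= h p) ->
  measurable_fun setT (fun x => \int[m]_(y in A) h (x, y)).
Proof.
move=> mA mh h0.
have mhA : measurable_fun setT (h \_ (setT `*` A)).
  apply/(measurable_restrictT _ _).1 => //; first exact: measurableX.
  exact: measurable_funS mh.
have hA0 p : 0 <= (h \_ (setT `*` A)) p by apply: erestrict_ge0.
have := measurable_fun_fubini_tonelli_F (m2 := m) _ mhA hA0.
congr measurable_fun; apply/funext => x; rewrite /fubini_F [RHS]integral_mkcond.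
apply: eq_integral => y _; rewrite /patch.
by congr (if _ then _ else _); apply/idP/idP; rewrite !inE => // -[].
Qed.

End partial_integral.

Section boxes.
Context {R : realType}.

(** Half-open, so that translates can tile the space. *)
Definition box d (c : 'rV[R]_d) (del : R) : set 'rV[R]_d :=
  [set x | forall i, c 0 i <= x 0 i < c 0 i + del].

Definition side (c del : R) : set (measurableTypeR R) := `[c, c + del[%classic.

Lemma measurable_side c del : measurable (side c del).
Proof. exact: measurable_itv. Qed.

Lemma lebesgue_side c del : 0 < del -> lebesgue_measure (side c del) = del%:E.
Proof.
move=> del0; rewrite /side lebesgue_measure_itv/= lte_fin ltrDl del0 -EFinB.
by rewrite addrC addKr.
Qed.

Lemma boxE d (c : 'rV[R]_d) del :
  box c del = [set x | forall i, side (c 0 i) del (x 0 i)].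
Proof. by apply/seteqP; split => x /= xc i; have := xc i; rewrite /side/= in_itv. Qed.

Lemma measurable_box d (c : 'rV[R]_d) del : measurable (box c del).
Proof.
rewrite (_ : box c del = \bigcap_(i in [set: 'I_d])
  ((fun x : 'rV[R]_d => x 0 i : measurableTypeR R) @^-1` side (c 0 i) del)).
  apply: fin_bigcap_measurable => // i _; rewrite -[X in measurable X]setTI.
  by apply: measurable_coord => //; exact: measurable_side.
by rewrite boxE; apply/seteqP; split=> x /= Ax i; [move=> _|]; exact: Ax.
Qed.

Lemma lebesgue_box d (c : 'rV[R]_d) del : 0 < del ->
  lebesgue_rV d (box c del) = (del ^+ d)%:E.
Proof.
move=> del0; have ms i := measurable_side (c 0 i) del.
rewrite boxE [LHS](lebesgue_rV_rect ms).
under eq_bigr do rewrite lebesgue_side//.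
by rewrite prodEFin prodr_const card_ord.
Qed.

Lemma box_cons d (c : 'rV[R]_d.+1) del s y :
  box c del (consrV (s, y)) <->
  side (c 0 0) del s /\ box (\row_i c 0 (lift 0 i)) del y.
Proof.
rewrite /side /= in_itv /=; split=> [h|[hs hy] i].
  split=> [|i]; first by have := h 0; rewrite consrV0.
  by have := h (lift 0 i); rewrite consrVS mxE.
have [j ->|->] := unliftP 0 i; last by rewrite consrV0.
by have := hy j; rewrite consrVS mxE.
Qed.

Local Open Scope ereal_scope.

Section integral_box.
Context (d : nat) (c : 'rV[R]_d.+1) (del : R) (F : 'rV[R]_d.+1 -> \bar R).
Hypotheses (mF : measurable_fun setT F) (F0 : forall x, 0 <= F x).
Let c' := \row_i c 0%R (lift 0%R i).

Let mFb : measurable_fun setT (F \_ (box c del)).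
Proof.
exact: ((measurable_restrictT F (measurable_box c del)).1
  (measurable_funS measurableT (@subsetT _ _) mF)).
Qed.

Let mFP : measurable_fun setT ((F \_ (box c del)) \o (@consrV R d)).
Proof. exact: measurableT_comp mFb (measurable_consrV (d := d)). Qed.

Let FP0 p : 0 <= ((F \_ (box c del)) \o (@consrV R d)) p.
Proof. by apply: erestrict_ge0. Qed.

Let integral_consrV : \int[lebesgue_rV d.+1]_(x in box c del) F x =
  \int[lebesgue_measure \x lebesgue_rV d]_p ((F \_ (box c del)) \o (@consrV R d)) p.
Proof.
rewrite integral_mkcond.
have := @ge0_integral_pushforward _ _ _ _ _ _ (measurable_consrV (d := d))
   (lebesgue_measure \x lebesgue_rV d) setT _ measurableT mFb.
by apply => x _; apply: erestrict_ge0.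
Qed.

Let patch_consrV s y : (F \_ (box c del)) (consrV (s, y)) =
  if s \in side (c 0%R 0%R) del
  then (fun y => F (consrV (s, y))) \_ (box c' del) y else 0.
Proof.
rewrite /patch; have := box_cons c del s y.
case: (asboolP (box c del (consrV (s, y)))) => h1 h2.
  have [s1 y1] := h2.1 h1.
  by rewrite !mem_set.
rewrite memNset//; case: ifPn => // /set_mem sI; case: ifPn => // /set_mem yI.
by exfalso; apply: h1; apply/h2.
Qed.

Lemma integral_box1 : \int[lebesgue_rV d.+1]_(x in box c del) F x =
  \int[lebesgue_measure]_(s in side (c 0%R 0%R) del)
    \int[lebesgue_rV d]_(y in box c' del) F (consrV (s, y)).
Proof.
rewrite integral_consrV (fubini_tonelli1 _ mFP FP0) [RHS]integral_mkcond.
apply: eq_integral => s _; rewrite /fubini_F [RHS]/patch.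
transitivity (\int[lebesgue_rV d]_y (if s \in side (c 0%R 0%R) del
    then (fun y => F (consrV (s, y))) \_ (box c' del) y else 0)).
  by apply: eq_integral => y _; exact: patch_consrV.
by case: ifPn => _; [rewrite -integral_mkcond|rewrite integral0].
Qed.

Lemma integral_box2 : \int[lebesgue_rV d.+1]_(x in box c del) F x =
  \int[lebesgue_rV d]_(y in box c' del)
    \int[lebesgue_measure]_(s in side (c 0%R 0%R) del) F (consrV (s, y)).
Proof.
rewrite integral_consrV (fubini_tonelli2 _ mFP FP0) [RHS]integral_mkcond.
apply: eq_integral => y _; rewrite /fubini_G [RHS]/patch.
transitivity (\int[lebesgue_measure]_s (if s \in side (c 0%R 0%R) del
    then (fun y => F (consrV (s, y))) \_ (box c' del) y else 0)).
  by apply: eq_integral => s _; exact: patch_consrV.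
case: ifPn => [yc|/negP yc].
  rewrite [RHS]integral_mkcond.
  by apply: eq_integral => s _; rewrite /patch yc; case: ifP.
rewrite (eq_integral (fun=> 0)) ?integral0// => s _.
by rewrite /patch; case: ifP => // _; case: ifP.
Qed.

End integral_box.
End boxes.

(** * A Poincare inequality on small cubes *)

Section slices.
Context {R : realType}.

Definition C1 d (f : 'rV[R]_d -> R) :=
  [/\ continuous f, forall i x, derivable f x (delta_mx 0 i) &
      forall i, continuous (partial i f)].

Lemma consrV_shift0 d h s (y : 'rV[R]_d) :
  consrV (h + s, y) = h *: delta_mx 0 0 + consrV (s, y).
Proof.
apply/rowP => i; rewrite [RHS]mxE [X in _ = X + _]mxE [X in _ = _ * X + _]mxE.
have [j ->|->] := unliftP 0 i.
  by rewrite !consrVS /= ?eqxx /= mulr0 add0r.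
by rewrite !consrV0 /= ?eqxx /= mulr1.
Qed.

Lemma consrV_shiftS d h s (y : 'rV[R]_d) i :
  consrV (s, h *: delta_mx 0 i + y) = h *: delta_mx 0 (lift 0 i) + consrV (s, y).
Proof.
apply/rowP => j; rewrite [RHS]mxE [X in _ = X + _]mxE [X in _ = _ * X + _]mxE.
have [k ->|->] := unliftP 0 j.
  by rewrite !consrVS !mxE (inj_eq (@lift_inj _ _)).
by rewrite !consrV0 /= mulr0 add0r.
Qed.

Lemma continuous_consrVl d (y : 'rV[R]_d) : continuous (fun s : R => consrV (s, y)).
Proof.
move=> s; apply/cvg_ballP => e e0; apply: filterS (nbhsx_ballx s e e0) => t st.
split=> // i j; rewrite ord1; have [k ->|->] := unliftP 0 j.
  by rewrite !consrVS; exact: ballxx.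
by rewrite !consrV0.
Qed.

Lemma continuous_consrVr d s : continuous (fun y : 'rV[R]_d => consrV (s, y)).
Proof.
move=> y U /nbhs_ballP[e /= e0 eU]; apply/nbhs_ballP; exists e => //= t [_ yt].
apply: eU; split=> // i j; rewrite ord1; have [k ->|->] := unliftP 0 j.
  by rewrite !consrVS; exact: yt.
by rewrite !consrV0; exact: ballxx.
Qed.

Lemma derive_slice0 d (f : 'rV[R]_d.+1 -> R) s y :
  (derivable f (consrV (s, y)) (delta_mx 0 0) ->
   derivable (fun s : R => f (consrV (s, y))) s 1) /\
  'D_1 (fun s : R => f (consrV (s, y))) s = partial 0 f (consrV (s, y)).
Proof.
rewrite /partial /derive /derivable.
suff -> : (fun h : R => h^-1 *: (((fun s : R => f (consrV (s, y))) \o shift s) (h *: 1)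
     - f (consrV (s, y)))) =
  (fun h : R => h^-1 *: ((f \o shift (consrV (s, y))) (h *: delta_mx 0 0) -
     f (consrV (s, y)))) by [].
apply/funext => h; congr (_ *: (f _ - _)) => /=.
by rewrite -consrV_shift0 /GRing.scale/= mulr1.
Qed.

Lemma derive_sliceS d (f : 'rV[R]_d.+1 -> R) s y i :
  (derivable f (consrV (s, y)) (delta_mx 0 (lift 0 i)) ->
   derivable (fun y => f (consrV (s, y))) y (delta_mx 0 i)) /\
  partial i (fun y => f (consrV (s, y))) y = partial (lift 0 i) f (consrV (s, y)).
Proof.
rewrite /partial /derive /derivable.
suff -> : (fun h : R => h^-1 *: (((fun y => f (consrV (s, y))) \o shift y) (h *: delta_mx 0 i)
     - f (consrV (s, y)))) =
  (fun h : R => h^-1 *: ((f \o shift (consrV (s, y))) (h *: delta_mx 0 (lift 0 i)) -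
     f (consrV (s, y)))) by [].
apply/funext => h; congr (_ *: (f _ - _)) => /=.
by rewrite -consrV_shiftS.
Qed.

Lemma C1_sliceS d (f : 'rV[R]_d.+1 -> R) s : C1 f ->
  C1 (fun y => f (consrV (s, y))).
Proof.
move=> [cf df cdf]; split=> [y|i y|i].
- by apply: continuous_comp; [exact: continuous_consrVr|exact: cf].
- by apply: (derive_sliceS f s y i).1; exact: df.
have -> : partial i (fun y => f (consrV (s, y))) =
    (fun y => partial (lift 0 i) f (consrV (s, y))).
  by apply/funext => y; exact: (derive_sliceS f s y i).2.
by move=> y; apply: continuous_comp; [exact: continuous_consrVr|exact: cdf].
Qed.

(** The fundamental theorem of calculus, then the Cauchy-Schwarz inequality
    against the constant 1. *)
Lemma oscillation_le (g : R -> R) (c del s t : R) : 0 < del ->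
  (forall x, derivable g x 1) -> continuous (fun x => 'D_1 g x) ->
  side c del s -> side c del t ->
  (((g s - g t) ^+ 2)%:E <=
   del%:E * \int[lebesgue_measure]_(r in side c del) (('D_1 g r) ^+ 2)%:E)%E.
Proof.
move=> del0 dg cdg; wlog st : s t / t < s => [hw|].
  case: (ltgtP t s) => [ts|st|->]; first exact: hw; last first.
    rewrite subrr expr0n/= => _ _; apply: mule_ge0; first by rewrite lee_fin ltW.
    by apply: integral_ge0 => x _; rewrite lee_fin sqr_ge0.
  by move=> h1 h2; rewrite -sqrrN opprB; exact: hw.
rewrite /side/= !in_itv/= => /andP[cs sc] /andP[ct tc].
set J := `[t, s]%classic : set (measurableTypeR R).
have mJ : measurable J by exact: measurable_itv.
have mdg : measurable_fun setT (fun x => 'D_1 g x) by exact: continuous_measurable_fun.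
have mJf (h : R -> R) : continuous h -> sqint lebesgue_measure J h.
  move=> ch; split.
    by apply: measurable_funTS; exact: continuous_measurable_fun.
  have : lebesgue_measure.-integrable J (EFin \o (fun x => h x ^+ 2)).
    apply: continuous_compact_integrable; first exact: segment_compact.
    by apply: continuous_subspaceT => x; apply: (@continuousM _ _ h h); exact: ch.
  move=> /integrableP[_]; congr (_ < _)%E; apply: eq_integral => x _.
  by rewrite /= ger0_norm ?sqr_ge0.
have g1 : sqint lebesgue_measure J (fun=> 1 : R).
  by apply: mJf => x; exact: cst_continuous.
have g2 := mJf _ cdg.
have := ip_cauchy_schwarz mJ g1 g2.
have ip1 : ip lebesgue_measure J (fun=> 1) (fun=> 1) = s - t.
  rewrite /ip/= mulr1 Rintegral_cst//= mul1r [lebesgue_measure _]lebesgue_measure_itv/=.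
  by rewrite lte_fin st.
have ip2 : ip lebesgue_measure J (fun=> 1) (fun x => 'D_1 g x) = g s - g t.
  rewrite /ip /Rintegral; under eq_integral do rewrite mul1r.
  rewrite (@continuous_FTC2 _ _ g)//.
  - exact: continuous_subspaceT.
  - have cg : continuous g by move=> x; apply/differentiable_continuous/derivable1_diffP.
    split=> [x _| |]; first exact: dg.
      by apply: cvg_at_right_filter; exact: cg.
    by apply: cvg_at_left_filter; exact: cg.
  - by move=> x _; rewrite derive1E.
rewrite ip1 ip2 -lee_fin [leRHS]EFinM (ipE mJ g2) => /le_trans; apply.
apply: lee_pmul => //; first by rewrite lee_fin subr_ge0 ltW.
- by apply: integral_ge0 => x _; rewrite lee_fin sqr_ge0.
- by rewrite lee_fin; lra.
apply: ge0_subset_integral => //.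
- apply/measurable_EFinP; apply: measurable_funX.
  by apply: measurable_funTS.
- by move=> x _; rewrite lee_fin sqr_ge0.
move=> x; rewrite /J /side/= !in_itv/= => /andP[tx xs].
by rewrite (le_trans ct tx) (le_lt_trans xs sc).
Qed.


Lemma measurable_C1 d (f : 'rV[R]_d -> R) : C1 f -> measurable_fun setT f.
Proof. by case=> cf _ _; exact: continuous_measurable_rV. Qed.

Definition energy d (f : 'rV[R]_d -> R) x : \bar R :=
  (\sum_(i < d) partial i f x ^+ 2)%:E.

Lemma energy_ge0 d (f : 'rV[R]_d -> R) x : (0 <= energy f x)%E.
Proof. by rewrite lee_fin sumr_ge0// => i _; rewrite sqr_ge0. Qed.

Lemma measurable_energy d (f : 'rV[R]_d -> R) : C1 f ->
  measurable_fun setT (energy f).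
Proof.
case=> _ _ cdf; apply/measurable_EFinP; apply: measurable_sum => i.
by apply: measurable_funX; exact: continuous_measurable_rV.
Qed.

Local Open Scope ereal_scope.

(** The mean square oscillation over a cube is controlled one variable at a
    time, moving from [(s, y)] to [(s, z)] and then to [(t, z)]: the first move
    the induction hypothesis on the slice through [s], the second one is the
    fundamental theorem of calculus. Splitting the square of the sum of the two
    moves doubles the constant at each dimension. *)
Lemma box_oscillation_le d (c : 'rV[R]_d) (del : R) (f : 'rV[R]_d -> R) :
  (0 < del)%R -> C1 f ->
  \int[lebesgue_rV d]_(x in box c del) \int[lebesgue_rV d]_(y in box c del)
     ((f x - f y) ^+ 2)%:E <=
  (2 ^+ d * del ^+ 2 * del ^+ d)%:E *
     \int[lebesgue_rV d]_(x in box c del) energy f x.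
Proof.
move=> del0; elim: d c f => [|d IH] c f hf.
  rewrite (eq_integral (fun=> 0)) => [|x _].
    rewrite integral0 mule_ge0//; first by rewrite lee_fin !mulr_ge0// ?exprn_ge0// ltW.
    by apply: integral_ge0 => x _; exact: energy_ge0.
  rewrite (eq_integral (fun=> 0)) ?integral0// => y _.
  by rewrite (thinmx0 x) (thinmx0 y) subrr expr0n.
have [cf df cdf] := hf.
have mf := measurable_C1 hf.
pose c' := (\row_i c 0 (lift 0 i))%R : 'rV[R]_d.
pose I := side (c 0%R 0%R) del.
have mI : measurable I := measurable_side _ _.
have lI : lebesgue_measure I = del%:E := lebesgue_side _ del0.
have mA := measurable_box c' del.
pose G z := \int[lebesgue_measure]_(r in I) ((partial 0%R f (consrV (r, z)) ^+ 2)%:E).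
pose V s y := \int[lebesgue_rV d]_(z in box c' del)
   ((f (consrV (s, y)) - f (consrV (s, z))) ^+ 2)%:E.
pose H s := \int[lebesgue_rV d]_(y in box c' del) energy (fun y => f (consrV (s, y))) y.
pose g := \int[lebesgue_rV d]_(z in box c' del) G z.
have mP := @measurable_consrV R d.
have mslice s : measurable_fun setT (fun y => f (consrV (s, y))).
  exact: measurable_C1 (C1_sliceS s hf).
have mG : measurable_fun setT G.
  apply: (@measurable_partial_integral _ _ _ _ _ lebesgue_measure I
    (fun p => (partial 0%R f (consrV (p.2, p.1)) ^+ 2)%:E)) => //; last first.
    by move=> p; rewrite lee_fin sqr_ge0.
  apply/measurable_EFinP; apply: measurable_funX.
  apply: (measurableT_comp (continuous_measurable_rV (cdf 0%R))).
  by apply: (measurableT_comp mP); exact: measurable_swap.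
have mV s : measurable_fun setT (V s).
  apply: (@measurable_partial_integral _ _ _ _ _ (lebesgue_rV d) (box c' del)
    (fun p => ((f (consrV (s, p.1)) - f (consrV (s, p.2))) ^+ 2)%:E)) => //; last first.
    by move=> p; rewrite lee_fin sqr_ge0.
  apply/measurable_EFinP; apply: measurable_funX; apply: measurable_funB.
    exact: (measurableT_comp (mslice s) measurable_fst).
  exact: (measurableT_comp (mslice s) measurable_snd).
pose rest x := (\sum_(i < d) partial (lift 0%R i) f x ^+ 2)%:E.
have mrest : measurable_fun setT rest.
  apply/measurable_EFinP; apply: measurable_sum => i.
  by apply: measurable_funX; exact: continuous_measurable_rV.
have rest0 x : 0 <= rest x by rewrite lee_fin sumr_ge0// => i _; rewrite sqr_ge0.
have energyE s y : energy (fun y => f (consrV (s, y))) y = rest (consrV (s, y)).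
  by congr (_%:E); apply: eq_bigr => i _; rewrite (derive_sliceS f s y i).2.
have mH : measurable_fun setT H.
  rewrite (_ : H = fun s => \int[lebesgue_rV d]_(y in box c' del) rest (consrV (s, y))).
    apply: (@measurable_partial_integral _ _ _ _ _ (lebesgue_rV d) (box c' del)
      (fun p => rest (consrV p))) => //.
    exact: (measurableT_comp mrest mP).
  by apply/funext => s; apply: eq_integral => y _; exact: energyE.
have G0 z : 0 <= G z by apply: integral_ge0 => r _; rewrite lee_fin sqr_ge0.
have V0 s y : 0 <= V s y by apply: integral_ge0 => r _; rewrite lee_fin sqr_ge0.
have H0 s : 0 <= H s by apply: integral_ge0 => r _; exact: energy_ge0.
have g0 : 0 <= g by apply: integral_ge0.
have del2 : (0 <= 2 * del)%R by rewrite mulr_ge0// ltW.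
have osc s t z : I s -> I t ->
    ((f (consrV (s, z)) - f (consrV (t, z))) ^+ 2)%:E <= del%:E * G z.
  move=> Is It; rewrite /G.
  have dE r : 'D_1 (fun s : R => f (consrV (s, z))) r = partial 0%R f (consrV (r, z)).
    exact: (derive_slice0 f r z).2.
  have := @oscillation_le (fun s => f (consrV (s, z))) (c 0 0)%R del s t del0.
  under eq_integral do rewrite dE.
  apply => // [r|].
    by apply: (derive_slice0 f r z).1; exact: df.
  rewrite (funext dE) => r; apply: continuous_comp; last exact: cdf.
  exact: continuous_consrVl.
have inner s y t : I s -> I t ->
  \int[lebesgue_rV d]_(z in box c' del)
    ((f (consrV (s, y)) - f (consrV (t, z))) ^+ 2)%:E <=
  2%:E * V s y + (2 * del)%:E * g.
  move=> Is It.
  have mVz : measurable_fun (box c' del)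
      (fun z => ((f (consrV (s, y)) - f (consrV (s, z))) ^+ 2)%:E).
    apply/measurable_EFinP; apply: measurable_funX; apply: measurable_funTS.
    by apply: measurable_funB => //; exact: measurable_cst.
  rewrite /V /g -!ge0_integralZl_EFin//; last 2 first.
  - exact: measurable_funTS.
  - by move=> z _; rewrite lee_fin sqr_ge0.
  rewrite -ge0_integralD//.
  - apply: ge0_le_lower_integral => [z _|z _]; first by rewrite lee_fin sqr_ge0.
    apply: (@le_trans _ _ (2%:E * ((f (consrV (s, y)) - f (consrV (s, z))) ^+ 2)%:E
        + 2%:E * ((f (consrV (s, z)) - f (consrV (t, z))) ^+ 2)%:E)).
      rewrite -!EFinM -EFinD lee_fin.
      have := sqr_ge0 (f (consrV (s, y)) - f (consrV (s, z)) -
        (f (consrV (s, z)) - f (consrV (t, z))))%R.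
      by move: (f _) (f _) (f _) => u v r; nra.
    by rewrite leeD2l// [(2 * del)%:E]EFinM -muleA lee_wpmul2l// osc.
  - by move=> z _; rewrite mule_ge0// lee_fin sqr_ge0.
  - exact: measurable_funeM.
  - by move=> z _; rewrite mule_ge0.
  - by apply: measurable_funeM; exact: measurable_funTS.
have mid s y : I s -> \int[lebesgue_rV d.+1]_(x in box c del)
    ((f (consrV (s, y)) - f x) ^+ 2)%:E <=
    (2 * del)%:E * V s y + (2 * del ^+ 2)%:E * g.
  move=> Is; rewrite integral_box1; last 2 first.
  - apply/measurable_EFinP; apply: measurable_funX.
    by apply: measurable_funB => //; exact: measurable_cst.
  - by move=> x; rewrite lee_fin sqr_ge0.
  apply: (@le_trans _ _ (\int[lebesgue_measure]_(t in I)
      cst (2%:E * V s y + (2 * del)%:E * g) t)).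
    apply: ge0_le_lower_integral => [t _|t It]; last exact: inner.
    by apply: integral_ge0 => z _; rewrite lee_fin sqr_ge0.
  rewrite integral_cst// [X in _ * X]lI muleDl// ?ge0_adde_def ?inE ?mule_ge0//.
  rewrite muleAC -EFinM muleAC -EFinM.
  by rewrite -mulrA -expr2.
have outer s : I s -> \int[lebesgue_rV d]_(y in box c' del)
    \int[lebesgue_rV d.+1]_(x in box c del) ((f (consrV (s, y)) - f x) ^+ 2)%:E <=
    (2 * del * (2 ^+ d * del ^+ 2 * del ^+ d))%:E * H s +
    (2 * del ^+ 2 * del ^+ d)%:E * g.
  move=> Is; apply: (@le_trans _ _ (\int[lebesgue_rV d]_(y in box c' del)
      ((2 * del)%:E * V s y + (2 * del ^+ 2)%:E * g))).
    apply: ge0_le_lower_integral => [y _|y _]; last exact: mid.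
    by apply: integral_ge0 => z _; rewrite lee_fin sqr_ge0.
  rewrite ge0_integralD//; last 3 first.
  - by move=> y _; rewrite mule_ge0.
  - by apply: measurable_funeM; exact: measurable_funTS.
  - by move=> y _; rewrite mule_ge0// lee_fin mulr_ge0 ?sqr_ge0.
  rewrite ge0_integralZl_EFin//; last exact: measurable_funTS.
  apply: leeD.
    by rewrite [(2 * del * (_ * _))%:E]EFinM -muleA lee_wpmul2l// IH//; exact: C1_sliceS.
  by rewrite integral_cst// [X in _ * X <= _](lebesgue_box c' del0) muleAC -EFinM.
have -> : \int[lebesgue_rV d.+1]_(x in box c del) energy f x =
    g + \int[lebesgue_measure]_(s in I) H s.
  transitivity (\int[lebesgue_rV d.+1]_(x in box c del)
      (((partial 0%R f x) ^+ 2)%:E + rest x)).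
    by apply: eq_integral => x _; rewrite /energy big_ord_recl EFinD.
  have m0 : measurable_fun setT (fun x => ((partial 0%R f x) ^+ 2)%:E).
    by apply/measurable_EFinP; apply: measurable_funX; exact: continuous_measurable_rV.
  have mB := measurable_box c del.
  rewrite ge0_integralD//; last 3 first.
  - by move=> x _; rewrite lee_fin sqr_ge0.
  - exact: measurable_funTS.
  - exact: measurable_funTS.
  congr (_ + _); first by rewrite integral_box2// => x; rewrite lee_fin sqr_ge0.
  rewrite (integral_box1 c del mrest rest0).
  apply: eq_integral => s _.
  by apply: eq_integral => y _; rewrite energyE.
have mosc : measurable_fun setT (fun x => \int[lebesgue_rV d.+1]_(y in box c del)
    ((f x - f y) ^+ 2)%:E).
  apply: (@measurable_partial_integral _ _ _ _ _ (lebesgue_rV d.+1) (box c del)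
    (fun p => ((f p.1 - f p.2) ^+ 2)%:E)); first exact: measurable_box.
    apply/measurable_EFinP; apply: measurable_funX; apply: measurable_funB.
      exact: (measurableT_comp mf measurable_fst).
    exact: (measurableT_comp mf measurable_snd).
  by move=> p; rewrite lee_fin sqr_ge0.
have osc0 x : 0 <= \int[lebesgue_rV d.+1]_(y in box c del) ((f x - f y) ^+ 2)%:E.
  by apply: integral_ge0 => y _; rewrite lee_fin sqr_ge0.
rewrite (integral_box1 c del mosc osc0).
have IH0 : 0 <= \int[lebesgue_measure]_(s in I) H s by apply: integral_ge0.
apply: (@le_trans _ _ (\int[lebesgue_measure]_(s in I)
    ((2 * del * (2 ^+ d * del ^+ 2 * del ^+ d))%:E * H s +
    (2 * del ^+ 2 * del ^+ d)%:E * g))).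
  by apply: ge0_le_lower_integral => [s _|s]; [exact: integral_ge0|exact: outer].
have p0 n : (0 <= del ^+ n)%R by rewrite exprn_ge0// ltW.
have K0 : (0 <= 2 * del * (2 ^+ d * del ^+ 2 * del ^+ d))%R.
  by do 3![apply: mulr_ge0 => //]; exact: exprn_ge0.
have K1 : (0 <= 2 * del ^+ 2 * del ^+ d)%R by do 2![apply: mulr_ge0 => //].
rewrite ge0_integralD//; last 3 first.
- by move=> s _; rewrite mule_ge0.
- by apply: measurable_funeM; exact: measurable_funTS.
- by move=> s _; rewrite mule_ge0.
rewrite ge0_integralZl_EFin//; last exact: measurable_funTS.
rewrite integral_cst// [X in _ + _ * X]lI muleAC -EFinM.
move: IH0; set J := \int[lebesgue_measure]_(s in I) H s => J0.
rewrite [leRHS]ge0_muleDr// [leLHS]addeC; apply: leeD.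
  rewrite lee_wpmul2r// lee_fin.
  have -> : (2 * del ^+ 2 * del ^+ d * del = 2 * 1 * del ^+ 2 * del ^+ d.+1)%R.
    by rewrite [(del ^+ d.+1)%R]exprS; ring.
  rewrite ler_wpM2r// ler_wpM2r// exprS ler_wpM2l// -[leLHS](expr1n R d).
  by rewrite lerXn2r// ?nnegrE//; lra.
rewrite lee_wpmul2r// lee_fin le_eqVlt; apply/orP; left; apply/eqP.
by rewrite [(del ^+ d.+1)%R]exprS [(2 ^+ d.+1)%R]exprS; ring.
Qed.
End slices.

(** The variance identity on a cube, divided by the volume. *)
Lemma box_poincare {R : realType} d (c : 'rV[R]_d) (del : R) (f : 'rV[R]_d -> R) :
  0 < del -> C1 f -> sqint (lebesgue_rV d) (box c del) f ->
  (\int[lebesgue_rV d]_(x in box c del) (f x ^+ 2)%:E <=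
  (2 ^+ d * del ^+ 2)%:E * \int[lebesgue_rV d]_(x in box c del) energy f x +
  ((del ^+ d)^-1 * ip (lebesgue_rV d) (box c del) f (fun=> 1) ^+ 2)%:E)%E.
Proof.
move=> del0 hf sf; have mB := measurable_box c del.
have lB : lebesgue_rV d (box c del) = (del ^+ d)%:E := lebesgue_box c del0.
have lfin : (lebesgue_rV d (box c del) < +oo)%E by rewrite lB ltry.
have := box_oscillation_le c del0 hf.
rewrite (mean_oscillationE mB lfin sf) [X in fine X]lB /= -(ipE mB sf).
have v0 : 0 < del ^+ d by rewrite exprn_gt0.
set q := ip _ _ f f; set m := ip _ _ f _.
set E := (\int[_]_(x in _) energy f x)%E.
have : (0 <= E)%E by apply: integral_ge0 => x _; exact: energy_ge0.
case: E => [e||] //; last first.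
  by move=> _ _; rewrite gt0_muley ?lte_fin ?mulr_gt0 ?exprn_gt0// addye// leey.
rewrite !lee_fin => e0 h.
rewrite -(ler_pM2l v0) mulrDr mulVKf ?gt_eqF//.
have q0 : 0 <= q := ip_ge0 _ _ _.
have K0 : 0 <= 2 ^+ d * del ^+ 2 * e by rewrite !mulr_ge0 ?exprn_ge0// ltW.
by nra.
Qed.

(** * Test functions *)

Section test_functions.
Context {R : realType} {d : nat}.
Implicit Types (Omega : set 'rV[R]_d) (f g phi psi : 'rV[R]_d -> R).

Lemma partial_lin i a f g :
  (forall x, derivable f x (delta_mx 0 i)) ->
  (forall x, derivable g x (delta_mx 0 i)) ->
  (forall x, derivable (fun x => a * f x + g x) x (delta_mx 0 i)) /\
  partial i (fun x => a * f x + g x) = (fun x => a * partial i f x + partial i g x).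
Proof.
move=> df dg; rewrite -[fun x => a * f x + g x]/((a \*: f) + g).
split=> [x|]; first by apply: derivableD => //; exact: derivableZ.
apply/funext => x; rewrite /partial deriveD//; last exact: derivableZ.
by rewrite deriveZ.
Qed.

Lemma foldr_partial_lin s a f g : smooth f -> smooth g ->
  foldr (@partial R d) (fun x => a * f x + g x) s =
  (fun x => a * foldr (@partial R d) f s x + foldr (@partial R d) g s x).
Proof.
move=> sf sg; elim: s => [//|i s IH] /=; rewrite IH.
by apply: (partial_lin _ _ _).2 => x; [exact: (sf s).2|exact: (sg s).2].
Qed.

Lemma smooth_lin a f g : smooth f -> smooth g -> smooth (fun x => a * f x + g x).
Proof.
move=> sf sg s /=; rewrite foldr_partial_lin//; split=> [x|x i].
  apply: (@continuousD _ _ _ (fun x => a * foldr (@partial R d) f s x)).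
    by apply: (@continuousM _ _ (fun=> a)); [exact: cst_continuous|exact: (sf s).1].
  exact: (sg s).1.
by apply: (partial_lin _ _ _).1 => y; [exact: (sf s).2|exact: (sg s).2].
Qed.

Lemma smooth0 : smooth (fun _ : 'rV[R]_d => 0 : R).
Proof.
move=> s /=; suff -> : foldr (@partial R d) (fun=> 0) s = (fun=> 0).
  by split=> [x|x i]; [exact: cst_continuous|exact: derivable_cst].
by elim: s => //= i s ->; apply/funext => x; exact: derive_cst.
Qed.

Lemma test_function_lin Omega a phi psi : test_function Omega phi ->
  test_function Omega psi -> test_function Omega (fun x => a * phi x + psi x).
Proof.
move=> [s1 c1 i1] [s2 c2 i2].
have sub : closure [set x | a * phi x + psi x != 0] `<=`
    closure [set x | phi x != 0] `|` closure [set x | psi x != 0].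
  rewrite -closureU; apply: closure_subset => x /= h.
  have [p0|] := eqVneq (phi x) 0; last by left.
  by right; move: h; rewrite p0 mulr0 add0r.
split; first exact: smooth_lin.
  by apply: subclosed_compact sub; [exact: closed_closure|exact: compactU].
by apply: subset_trans sub _; rewrite subUset.
Qed.

Lemma test_function0 Omega : test_function Omega (fun=> 0).
Proof.
have e : [set x : 'rV[R]_d | (fun=> 0 : R) x != 0] = set0.
  by apply/seteqP; split=> x //=; rewrite eqxx.
by split; [exact: smooth0|rewrite e closure0; exact: compact0|rewrite e closure0].
Qed.

Lemma test_function_C1 Omega phi : test_function Omega phi -> C1 phi.
Proof.
move=> [s _ _]; split=> [|i x|i]; first exact: (s [::]).1.
  exact: (s [::]).2.
exact: (s [:: i]).1.
Qed.

Lemma test_function_out Omega phi x : test_function Omega phi -> ~ Omega x ->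
  phi x = 0 /\ forall i, partial i phi x = 0.
Proof.
move=> [_ _ sub] nx; set K := closure _ in sub.
have nK : ~ K x by move/sub.
split=> [|i].
  by apply: contra_notP nK => /eqP p0; exact: subset_closure.
transitivity ('D_(delta_mx 0 i) (fun _ : 'rV[R]_d => 0 : R) x).
  apply: near_eq_derive.
  have : nbhs x (~` K).
    apply: open_nbhs_nbhs; split => //; apply: closed_openC.
    exact: closed_closure.
  apply: filterS => y nKy; apply/eqP/negPn/negP => y0; apply: nKy.
  exact: subset_closure.
exact: derive_cst.
Qed.

Lemma compact_support_bounded (K : set 'rV[R]_d) g : compact K -> continuous g ->
  (forall x, ~ K x -> g x = 0) -> exists C, forall x, `|g x| <= C.
Proof.
move=> cK cg g0.
have cgK : compact (g @` K).
  by apply: continuous_compact => //; exact: continuous_subspaceT.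
have [M M0 hM] := pinfty_ex_gt0 (compact_bounded cgK).
exists M => x; have [Kx|/g0 ->] := pselect (K x); last by rewrite normr0 ltW.
by apply: hM; exists x.
Qed.

Lemma test_function_bounded Omega phi : test_function Omega phi ->
  (exists C, forall x, `|phi x| <= C) /\
  forall i, exists C, forall x, `|partial i phi x| <= C.
Proof.
move=> tphi; have [cf _ cdf] := test_function_C1 tphi.
have [s cK _] := tphi.
have out x := @test_function_out _ phi x (And3 s cK (@subset_refl _ _)).
split=> [|i]; first by apply: (compact_support_bounded cK) => // x /out[].
by apply: (compact_support_bounded cK) => // x /out[].
Qed.

Lemma test_function_sqint Omega phi (m : {measure set 'rV[R]_d -> \bar R}) D :
  measurable D -> (m D < +oo)%E -> test_function Omega phi ->
  sqint m D phi /\ forall i, sqint m D (partial i phi).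
Proof.
move=> mD Dfin tphi; have [cf _ cdf] := test_function_C1 tphi.
have [[C hC] h] := test_function_bounded tphi.
split=> [|i].
  apply: (@sqint_bounded _ _ _ m D mD Dfin phi C) => //.
  by apply: measurable_funTS; exact: continuous_measurable_rV.
have [C' hC'] := h i.
apply: (@sqint_bounded _ _ _ m D mD Dfin _ C') => //.
by apply: measurable_funTS; exact: continuous_measurable_rV.
Qed.

End test_functions.

(** * The space H^1_0 as a module *)

Section H10.
Context {R : realType} {d : nat} {Omega : set 'rV[R]_d}.
Hypotheses (oO : open Omega) (bO : bounded_set Omega).
Implicit Types p q r : sobolev_pair R d.

Let mO : measurable Omega. Proof. exact: open_measurable_rV. Qed.

Lemma bounded_subset_box : exists (c del : R), 0 < del /\
  Omega `<=` box (const_mx c) del.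
Proof.
have [M M0 hM] := pinfty_ex_gt0 bO.
exists (- (M + 1)), (2 * (M + 1)); split; first lra.
move=> x /hM xM i; rewrite mxE.
have : `|x 0 i| <= M.
  apply: le_trans xM.
  have := le_bigmax 0 (fun ij : 'I_1 * 'I_d => `|x ij.1 ij.2|) (0, i).
  by rewrite -mx_normrE.
by rewrite ler_norml; lra.
Qed.

Lemma bounded_lebesgue_lty : (lebesgue_rV d Omega < +oo)%E.
Proof.
have [c [del [del0 sub]]] := bounded_subset_box.
have := le_measure (lebesgue_rV d) (mem_set mO) (mem_set (measurable_box _ _)) sub.
by move=> /le_lt_trans; apply; rewrite [ltLHS]lebesgue_box// ltry.
Qed.

Notation msq := (sqint (lebesgue_rV d) Omega).
Notation dot := (ip (lebesgue_rV d) Omega).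

(** The conditions of H^1 except the one relating the two components. *)
Definition sq_pair p := msq (fct p) /\ forall i, msq (fun x => grad p x 0 i).

Definition lin_pair (a : R) p q := SobolevPair
  (fun x => a * fct p x + fct q x) (fun x => a *: grad p x + grad q x).

Definition h1_sqnorm p := l2_dot Omega p p + dirichlet_form Omega p p.

Lemma dirichlet_formE p q : sq_pair p -> sq_pair q ->
  dirichlet_form Omega p q =
  \sum_(i < d) dot (fun x => grad p x 0 i) (fun x => grad q x 0 i).
Proof.
move=> [_ hp] [_ hq]; rewrite /dirichlet_form Rintegral_sum// => i.
exact: sqint_mul_integrable.
Qed.

Let grad_lin a p q i : (fun x => grad (lin_pair a p q) x 0 i) =
  (fun x => a * grad p x 0 i + grad q x 0 i).
Proof. by apply/funext => x; rewrite !mxE. Qed.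

Lemma sq_lin a p q : sq_pair p -> sq_pair q -> sq_pair (lin_pair a p q).
Proof.
move=> [p1 p2] [q1 q2]; split; first exact: sqint_lin.
by move=> i; rewrite grad_lin; exact: sqint_lin.
Qed.

Lemma l2_dot_lin a p q r : sq_pair p -> sq_pair q -> sq_pair r ->
  l2_dot Omega (lin_pair a p q) r = a * l2_dot Omega p r + l2_dot Omega q r.
Proof. by move=> [p1 _] [q1 _] [r1 _]; exact: ip_lin. Qed.

Lemma dirichlet_form_lin a p q r : sq_pair p -> sq_pair q -> sq_pair r ->
  dirichlet_form Omega (lin_pair a p q) r =
  a * dirichlet_form Omega p r + dirichlet_form Omega q r.
Proof.
move=> hp hq hr; rewrite !dirichlet_formE//; last exact: sq_lin.
rewrite mulr_sumr -big_split/=; apply: eq_bigr => i _.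
by rewrite grad_lin ip_lin//; [exact: hp.2|exact: hq.2|exact: hr.2].
Qed.

Lemma l2_dotC p q : l2_dot Omega p q = l2_dot Omega q p.
Proof. exact: ipC. Qed.

Lemma dirichlet_formC p q : dirichlet_form Omega p q = dirichlet_form Omega q p.
Proof. by apply: eq_Rintegral => x _; apply: eq_bigr => i _; rewrite mulrC. Qed.

Lemma l2_dot_ge0 p : 0 <= l2_dot Omega p p.
Proof. exact: ip_ge0. Qed.

Lemma dirichlet_form_ge0 p : 0 <= dirichlet_form Omega p p.
Proof.
by apply: Rintegral_ge0 => x _; apply: sumr_ge0 => i _; rewrite -expr2 sqr_ge0.
Qed.

Lemma l2_dot_lin_le a p q : sq_pair p -> sq_pair q ->
  l2_dot Omega (lin_pair a p q) (lin_pair a p q) <=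
  2 * a ^+ 2 * l2_dot Omega p p + 2 * l2_dot Omega q q.
Proof. by move=> hp hq; exact: (ip_lin_le mO a hp.1 hq.1). Qed.

Lemma dirichlet_form_lin_le a p q : sq_pair p -> sq_pair q ->
  dirichlet_form Omega (lin_pair a p q) (lin_pair a p q) <=
  2 * a ^+ 2 * dirichlet_form Omega p p + 2 * dirichlet_form Omega q q.
Proof.
move=> hp hq; have hl := sq_lin a hp hq.
rewrite !dirichlet_formE// !mulr_sumr -big_split/=; apply: ler_sum => i _.
by rewrite grad_lin; apply: ip_lin_le => //; [exact: hp.2|exact: hq.2].
Qed.

Lemma h1_sqnorm_lin_le a p q : sq_pair p -> sq_pair q ->
  h1_sqnorm (lin_pair a p q) <= 2 * a ^+ 2 * h1_sqnorm p + 2 * h1_sqnorm q.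
Proof.
move=> hp hq; rewrite /h1_sqnorm !mulrDr addrACA.
by rewrite lerD ?l2_dot_lin_le ?dirichlet_form_lin_le.
Qed.

Definition test_pair (phi : 'rV[R]_d -> R) := SobolevPair phi (gradient phi).

Lemma test_pair_sq phi : test_function Omega phi -> sq_pair (test_pair phi).
Proof.
move=> /(test_function_sqint mO bounded_lebesgue_lty)[h1 h2]; split=> // i.
by rewrite (_ : (fun x => _) = partial i phi)//; apply/funext => x; rewrite mxE.
Qed.

Lemma weak_gradient_lin a p q : sq_pair p -> sq_pair q ->
  weak_gradient Omega p -> weak_gradient Omega q ->
  weak_gradient Omega (lin_pair a p q).
Proof.
move=> [p1 p2] [q1 q2] wp wq phi i tphi.
have [h1 h2] := test_function_sqint mO bounded_lebesgue_lty tphi.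
have := ip_lin mO a p1 q1 (h2 i).
rewrite {2 3}/ip wp// wq// => /= e; rewrite [LHS]e.
transitivity (- dot (fun x => a * grad p x 0 i + grad q x 0 i) phi).
  by rewrite ip_lin// opprD mulrN.
by congr (- _); apply: eq_Rintegral => x _; rewrite !mxE.
Qed.

Lemma sub_pairE p q : sub_pair p q = lin_pair (-1) q p.
Proof.
congr SobolevPair; apply/funext => x; first by rewrite mulN1r addrC.
by rewrite scaleN1r addrC.
Qed.

Lemma sq_sub p q : sq_pair p -> sq_pair q -> sq_pair (sub_pair p q).
Proof. by move=> hp hq; rewrite sub_pairE; exact: sq_lin. Qed.

Lemma H10_sq p : H10 Omega p -> sq_pair p.
Proof. by move=> [[p1 p2 _] _]. Qed.

Lemma H10_lin a p q : H10 Omega p -> H10 Omega q -> H10 Omega (lin_pair a p q).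
Proof.
move=> hp hq.
have bound (e : R) : 0 < e -> 2 * a ^+ 2 * (e / (4 * (a ^+ 2 + 1))) <= e / 2.
  move=> e0; have := sqr_ge0 a; move: (a ^+ 2) => b b0.
  rewrite (_ : _ * _ = e / 2 * (b / (b + 1))); last by field; lra.
  rewrite ler_piMr ?ler_pdivrMr//; lra.
have sp := H10_sq hp; have sq := H10_sq hq.
have [s1 s2] := sq_lin a sp sq.
have [[_ _ wp] ap] := hp; have [[_ _ wq] aq] := hq.
split; first by split=> //; exact: weak_gradient_lin.
move=> e e0.
have e1 : 0 < e / (4 * (a ^+ 2 + 1)).
  by rewrite divr_gt0// mulr_gt0//; have := sqr_ge0 a; lra.
have [phi tphi hphi] := ap _ e1.
have [psi tpsi hpsi] := aq (e / 4) ltac:(lra).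
exists (fun x => a * phi x + psi x); first exact: test_function_lin.
have tp := test_pair_sq tphi; have tq := test_pair_sq tpsi.
have [[_ dphi _] [_ dpsi _]] := (test_function_C1 tphi, test_function_C1 tpsi).
rewrite [sub_pair _ _](_ : _ =
    lin_pair a (sub_pair p (test_pair phi)) (sub_pair q (test_pair psi))).
  have /le_lt_trans := h1_sqnorm_lin_le a (sq_sub sp tp) (sq_sub sq tq).
  apply.
  have {}hphi : h1_sqnorm (sub_pair p (test_pair phi)) <
    e / (4 * (a ^+ 2 + 1)) := hphi.
  have {}hpsi : h1_sqnorm (sub_pair q (test_pair psi)) < e / 4 := hpsi.
  have : 2 * a ^+ 2 * h1_sqnorm (sub_pair p (test_pair phi)) <=
      2 * a ^+ 2 * (e / (4 * (a ^+ 2 + 1))).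
    by apply: ler_wpM2l (ltW hphi); rewrite mulr_ge0// sqr_ge0.
  move: (h1_sqnorm _) (h1_sqnorm _) hphi hpsi => u v hphi hpsi h1.
  have := bound e e0; clear -h1 hpsi; lra.
congr SobolevPair; apply/funext => x /=; first by ring.
apply/rowP => i; rewrite !mxE (partial_lin _ _ _).2//; ring.
Qed.

Lemma H10_0 : H10 Omega (SobolevPair (fun=> 0) (fun=> 0)).
Proof.
have s0 : msq (fun=> 0) by exact: sqint0.
have g0 i : (fun x : 'rV[R]_d => (fun=> 0 : 'rV[R]_d) x 0 i) = (fun=> 0).
  by apply/funext => x; rewrite mxE.
have int0 (g : 'rV[R]_d -> R) : (forall x, g x = 0) ->
    \int[lebesgue_rV d]_(x in Omega) g x = 0.
  by move=> g0'; rewrite /Rintegral integral0_eq// => x _; rewrite g0'.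
split.
  split=> // [i|phi i _]; first by rewrite /= g0.
  rewrite (int0 (fun x => _)) => [|x]; last by rewrite mul0r.
  by rewrite (int0 (fun x => _)) ?oppr0// => x; rewrite mxE mul0r.
move=> e e0; exists (fun=> 0); first exact: test_function0.
rewrite /=; set r := sub_pair _ _.
have r1 x : fct r x = 0 by rewrite /= subrr.
have r2 x i : grad r x 0 i = 0.
  by rewrite !mxE /partial derive_cst subrr.
rewrite /l2_dot /dirichlet_form (int0 (fun x => _)) => [|x]; last by rewrite r1 mulr0.
rewrite (int0 (fun x => _)) ?addr0// => x.
by rewrite big1// => i _; rewrite !r2 mulr0.
Qed.

End H10.

(** * Completeness and compactness of H^1_0 *)

Section H10_topology.
Context {R : realType} {d : nat} {Omega : set 'rV[R]_d}.
Hypotheses (oO : open Omega) (bO : bounded_set Omega).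
Implicit Types p q r : sobolev_pair R d.

Let mO : measurable Omega. Proof. exact: open_measurable_rV. Qed.
Let Ofin : (lebesgue_rV d Omega < +oo)%E. Proof. exact: bounded_lebesgue_lty. Qed.

Notation msq := (sqint (lebesgue_rV d) Omega).
Notation dot := (ip (lebesgue_rV d) Omega).
Notation H1norm := (@h1_sqnorm R d Omega).

Lemma h1_sqnormE r : @sq_pair R d Omega r -> H1norm r =
  dot (fct r) (fct r) +
  \sum_(i < d) dot (fun x => grad r x 0 i) (fun x => grad r x 0 i).
Proof. by move=> hr; rewrite /h1_sqnorm (dirichlet_formE oO). Qed.

Let component_le r : @sq_pair R d Omega r ->
  dot (fct r) (fct r) <= H1norm r /\
  forall i, dot (fun x => grad r x 0 i) (fun x => grad r x 0 i) <= H1norm r.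
Proof.
move=> hr; rewrite (h1_sqnormE hr); split=> [|i].
  by rewrite lerDl sumr_ge0// => i _; exact: ip_ge0.
rewrite (bigD1 i)//= addrCA lerDl addr_ge0 ?ip_ge0//.
by rewrite sumr_ge0// => j _; exact: ip_ge0.
Qed.

Let fct_sub p q : fct (sub_pair p q) = (fun x => fct p x - fct q x).
Proof. by []. Qed.

Let grad_sub p q i : (fun x => grad (sub_pair p q) x 0 i) =
  (fun x => grad p x 0 i - grad q x 0 i).
Proof. by apply/funext => x; rewrite !mxE. Qed.

(** The defect in the weak gradient identity is continuous in H^1, for each
    fixed test function. *)
Lemma H1_weak_gradient_cvg (u : nat -> sobolev_pair R d) p :
  (forall n, H1 Omega (u n)) -> @sq_pair R d Omega p ->
  (forall e : R, 0 < e -> exists n, H1norm (sub_pair (u n) p) < e) ->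
  H1 Omega p.
Proof.
move=> Hu sp up; have [p1 p2] := sp; split=> // phi i tphi.
have [h1 /(_ i) h2] := test_function_sqint mO Ofin tphi.
apply/eqP; rewrite -addr_eq0; apply/eqP.
rewrite -[LHS]/(dot (fct p) (partial i phi) + dot (fun x => grad p x 0 i) phi).
set A := dot (partial i phi) (partial i phi); set B := dot phi phi.
apply: (@eq0_of_small_sqr R _ (2 * A + 2 * B)) => e e0 _.
have [n un] := up e e0; have [u1 u2 wu] := Hu n.
have sr : @sq_pair R d Omega (sub_pair (u n) p) by apply: sq_sub.
have [c1 /(_ i) c2] := component_le sr.
have := ip_cauchy_schwarz mO sr.1 h2; have := ip_cauchy_schwarz mO (sr.2 i) h1.
have w : dot (fct (u n)) (partial i phi) =
  - dot (fun x => grad (u n) x 0 i) phi := wu phi i tphi.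
have := ipBl mO (u2 i) (p2 i) h1; have := ipBl mO u1 p1 h2.
rewrite w -/A -/B -grad_sub -fct_sub.
have A0 : 0 <= A := ip_ge0 _ _ _; have B0 : 0 <= B := ip_ge0 _ _ _.
move: (le_lt_trans c1 un) (le_lt_trans c2 un) => {c1 c2 un w}.
move: A B A0 B0 (dot _ _) (dot _ _) (dot _ _) (dot _ _) (dot _ _) (dot _ _) (dot _ _).
clear; move=> A B A0 B0 a1 a2 a3 a4 a5 a6 a7.
move=> h7 h6 e3 e4 h4 h3.
have : a6 * B <= e * B by rewrite ler_wpM2r// ltW.
have : a7 * A <= e * A by rewrite ler_wpM2r// ltW.
have := sqr_ge0 (a3 - a4).
rewrite (_ : a2 + a1 = - (a3 + a4)); last by rewrite e3 e4; ring.
move: (a6 * B) (a7 * A) h4 h3 => ? ? ? ? ? ? ?.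
by rewrite sqrrN mulrDr !(mulrCA e); nra.
Qed.

(** Riesz-Fischer for the function and for each coordinate of the gradient;
    the limit inherits its approximation by test functions from a far term. *)
Lemma H10_complete (u : nat -> sobolev_pair R d) :
  (forall n, H10 Omega (u n)) ->
  (forall e : R, 0 < e -> exists k, forall i j, (k <= i)%N -> (k <= j)%N ->
     H1norm (sub_pair (u i) (u j)) < e) ->
  exists2 v, H10 Omega v & forall e : R, 0 < e -> exists k, forall i, (k <= i)%N ->
     H1norm (sub_pair (u i) v) < e.
Proof.
move=> Hu cu; have su n := H10_sq (Hu n).
have suB i j : @sq_pair R d Omega (sub_pair (u i) (u j)) by exact: sq_sub.
have [f hf cf] : exists2 f, msq f & forall e : R, 0 < e ->
    exists k, forall i, (k <= i)%N ->
    dot (fun x => fct (u i) x - f x) (fun x => fct (u i) x - f x) < e.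
  apply: (sqint_complete mO (f := fun n => fct (u n))) => [n|e e0].
    exact: (su n).1.
  have [k hk] := cu e e0; exists k => i j ki kj.
  exact: le_lt_trans (component_le (suB i j)).1 (hk i j ki kj).
have : forall j, exists g, msq g /\ forall e : R, 0 < e ->
    exists k, forall i, (k <= i)%N ->
    dot (fun x => grad (u i) x 0 j - g x) (fun x => grad (u i) x 0 j - g x) < e.
  move=> j; have [||g hg cg] := @sqint_complete _ _ _ (lebesgue_rV d) Omega mO
    (fun n x => grad (u n) x 0 j); last by exists g.
    by move=> n; exact: (su n).2.
  move=> e e0; have [k hk] := cu e e0; exists k => i l ki kl.
  rewrite -grad_sub.
  exact: le_lt_trans ((component_le (suB i l)).2 j) (hk i l ki kl).
move=> /choice[g hg].
pose v := SobolevPair f (fun x => \row_j g j x).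
have gv j : (fun x => grad v x 0 j) = g j by apply/funext => x; rewrite mxE.
have sv : @sq_pair R d Omega v by split=> // j; have := (hg j).1; rewrite -gv.
have cv (e : R) : 0 < e -> exists k, forall i, (k <= i)%N ->
    H1norm (sub_pair (u i) v) < e.
  move=> e0; have e1 : 0 < e / d.+1%:R by rewrite divr_gt0.
  have [k1 hk1] := cf _ e1.
  have /choice[k2 hk2] := fun j => (hg j).2 _ e1.
  exists (maxn k1 (\max_(j < d) k2 j)) => i; rewrite geq_max => /andP[i1 i2].
  have sr : @sq_pair R d Omega (sub_pair (u i) v) by exact: sq_sub.
  rewrite (h1_sqnormE sr) (_ : e = e / d.+1%:R + \sum_(j < d) e / d.+1%:R); last first.
    by rewrite sumr_const card_ord -mulrS -[RHS]mulr_natr divfK.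
  rewrite ltr_leD//; first exact: hk1.
  apply: ler_sum => j _; rewrite grad_sub.
  rewrite (_ : (fun x => _) = (fun x => grad (u i) x 0 j - g j x)); last first.
    by apply/funext => x; rewrite mxE.
  apply/ltW/hk2.
  by apply: leq_trans i2; exact: leq_bigmax.
exists v => //; split.
  apply: (H1_weak_gradient_cvg (u := u)) => // [n|e /cv[k hk]]; first exact: (Hu n).1.
  by exists k; exact: hk.
move=> e e0; have e4 : 0 < e / 4 by rewrite divr_gt0.
have [k /(_ k (leqnn k)) hk] := cv _ e4.
have [phi tphi hphi] := (Hu k).2 _ e4.
exists phi => //; change (H1norm (sub_pair v (test_pair phi)) < e).
have sphi := test_pair_sq oO bO tphi.
rewrite (_ : sub_pair v (test_pair phi) =
    lin_pair (-1) (sub_pair (u k) v) (sub_pair (u k) (test_pair phi))); last first.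
  congr SobolevPair; apply/funext => x /=; first by ring.
  by apply/rowP => j; rewrite !mxE; ring.
apply: le_lt_trans
  (h1_sqnorm_lin_le oO _ (sq_sub oO (su k) sv) (sq_sub oO (su k) sphi)) _.
have {}hphi : H1norm (sub_pair (u k) (test_pair phi)) < e / 4 := hphi.
move: (H1norm _) (H1norm _) hk hphi => a b; rewrite sqrrN expr1n.
by clear cv hf cf hg cu; lra.
Qed.

End H10_topology.

Section grid.
Context {R : realType} {d : nat} (c ell : R) (n : nat).
Hypothesis ell0 : 0 < ell.
Implicit Types z : {ffun 'I_d -> 'I_n.+1}.

Definition mesh := ell / n.+1%:R.

Definition cell z : set 'rV[R]_d := box (\row_i (c + (z i)%:R * mesh)) mesh.

Lemma mesh_gt0 : 0 < mesh. Proof. by rewrite divr_gt0. Qed.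

Lemma trivIset_cell : trivIset setT cell.
Proof.
apply/trivIsetP => z z' _ _; apply: contra_neqP => /eqP/set0P[x [xz xz']].
apply/ffunP => i; apply/val_inj/eqP; rewrite eqn_leq.
have := xz i; have := xz' i; rewrite !mxE => /andP[a1 a2] /andP[a3 a4].
by apply/andP; split; rewrite -ltnS -(ltr_nat R) -natr1 -(ltr_pM2r mesh_gt0)
  mulrDl mul1r; lra.
Qed.

Lemma box_sub_cells : box (const_mx c) ell `<=`
  \big[setU/set0]_(z <- index_enum {ffun 'I_d -> 'I_n.+1}) cell z.
Proof.
move=> x xb; rewrite -bigcup_seq.
exists [ffun i => inord (Num.truncn ((x 0 i - c) / mesh))].
  by rewrite /= mem_index_enum.
move=> i; rewrite mxE ffunE; have := xb i; rewrite mxE => /andP[x1 x2].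
have m0 := mesh_gt0.
have t0 : 0 <= (x 0 i - c) / mesh by rewrite divr_ge0 ?subr_ge0// ltW.
have := truncn_itv t0; set k := Num.truncn _ => /andP[k1 k2].
have kn : (k < n.+1)%N.
  rewrite -(ltr_nat R); apply: le_lt_trans k1 _.
  rewrite ltr_pdivrMr// /mesh mulrC divfK ?pnatr_eq0//; lra.
rewrite inordK//; move: k1 k2; rewrite ler_pdivlMr// ltr_pdivrMr// -natr1 mulrDl.
by move=> ? ?; apply/andP; split; lra.
Qed.

End grid.

Section H10_compact.
Context {R : realType} {d : nat} {Omega : set 'rV[R]_d}.
Hypotheses (oO : open Omega) (bO : bounded_set Omega).
Implicit Types p q r : sobolev_pair R d.

Let mO : measurable Omega. Proof. exact: open_measurable_rV. Qed.
Let Ofin : (lebesgue_rV d Omega < +oo)%E. Proof. exact: bounded_lebesgue_lty. Qed.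

Notation dot := (ip (lebesgue_rV d) Omega).

Lemma integral_support (h : 'rV[R]_d -> \bar R) (D : set 'rV[R]_d) :
  Omega `<=` D -> (forall x, ~ Omega x -> h x = 0%E) ->
  (\int[lebesgue_rV d]_(x in D) h x = \int[lebesgue_rV d]_(x in Omega) h x)%E.
Proof.
move=> sub h0; rewrite [LHS]integral_mkcond [RHS]integral_mkcond.
apply: eq_integral => x _; rewrite /patch.
have [Ox|nO] := pselect (Omega x); first by rewrite !mem_set//; exact: sub.
by rewrite (memNset nO); case: ifP => // _; exact: h0.
Qed.

(** Extended by zero, a test function is smooth on every cell, including the
    cells that meet the boundary of the domain: the Poincare inequality is used
    on full cubes only. *)
Lemma test_function_grid_poincare c ell n phi : 0 < ell ->
  Omega `<=` box (const_mx c) ell -> test_function Omega phi ->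
  dot phi phi <= 2 ^+ d * mesh ell n ^+ 2 *
      dirichlet_form Omega (test_pair phi) (test_pair phi) +
  \sum_(z : {ffun 'I_d -> 'I_n.+1})
     ((mesh ell n ^+ d)^-1 * dot phi \1_(cell c ell z) ^+ 2).
Proof.
move=> ell0 sub tphi; have [sphi sdphi] := test_function_sqint mO Ofin tphi.
have m0 := mesh_gt0 n ell0.
set D := \big[setU/set0]_(z <- index_enum {ffun 'I_d -> 'I_n.+1}) cell c ell z.
have subD : Omega `<=` D := subset_trans sub (@box_sub_cells R d c ell n ell0).
have mcell (z : {ffun 'I_d -> 'I_n.+1}) : measurable (cell c ell z).
  exact: measurable_box.
have C1phi := test_function_C1 tphi.
have split_cells (h : 'rV[R]_d -> \bar R) : measurable_fun setT h ->
    (forall x, 0 <= h x)%E -> (forall x, ~ Omega x -> h x = 0%E) ->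
    (\int[lebesgue_rV d]_(x in Omega) h x =
     \sum_(z <- index_enum {ffun 'I_d -> 'I_n.+1})
       \int[lebesgue_rV d]_(x in cell c ell z) h x)%E.
  move=> mh h0 hO; rewrite -(integral_support subD hO).
  apply: ge0_integral_bigsetU => //.
  - exact: index_enum_uniq.
  - by apply: sub_trivIset (@trivIset_cell R d c ell n ell0).
  - exact: measurable_funTS.
rewrite -lee_fin EFinD EFinM (ipE mO sphi).
have energyO x : ~ Omega x -> energy phi x = 0%E.
  move=> /(test_function_out tphi)[_ dphi].
  by rewrite /energy big1// => i _; rewrite dphi expr0n.
have -> : (dirichlet_form Omega (test_pair phi) (test_pair phi))%:E =
    (\int[lebesgue_rV d]_(x in Omega) energy phi x)%E.
  have gphi i : (fun x => grad (test_pair phi) x 0 i) = partial i phi.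
    by apply/funext => x; rewrite mxE.
  have st := test_pair_sq oO bO tphi.
  rewrite (dirichlet_formE oO st st) -sumEFin.
  under eq_bigr do rewrite gphi (ipE mO (sdphi _)).
  rewrite -ge0_integral_sum//; last 2 first.
  - by move=> i; apply/measurable_EFinP; apply: measurable_funX; exact: (sdphi i).1.
  - by move=> i x _; rewrite lee_fin sqr_ge0.
  by apply: eq_integral => x _; rewrite sumEFin.
have m2 : measurable_fun setT (fun x => (phi x ^+ 2)%:E).
  by apply/measurable_EFinP; apply: measurable_funX; exact: measurable_C1.
have m2_ge0 x : (0 <= (phi x ^+ 2)%:E)%E by rewrite lee_fin sqr_ge0.
have m2_out x : ~ Omega x -> (phi x ^+ 2)%:E = 0%E.
  by move=> /(test_function_out tphi)[-> _]; rewrite expr0n.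
rewrite (split_cells _ m2 m2_ge0 m2_out).
rewrite (split_cells _ (measurable_energy C1phi) (energy_ge0 phi) energyO).
rewrite ge0_sume_distrr; last first.
  by move=> z _; apply: integral_ge0 => x _; exact: energy_ge0.
rewrite -sumEFin -big_split/=; apply: lee_sum => z _.
have sz : sqint (lebesgue_rV d) (cell c ell z) phi.
  have lz : (lebesgue_rV d (cell c ell z) < +oo)%E by rewrite [ltLHS]lebesgue_box// ltry.
  by have [] := test_function_sqint (mcell z) lz tphi.
apply: le_trans (box_poincare m0 C1phi sz) _; rewrite leeD2l//.
rewrite lee_fin le_eqVlt; apply/orP; left; apply/eqP; congr (_ * _ ^+ 2).
rewrite /ip [LHS]Rintegral_mkcond [RHS]Rintegral_mkcond; apply: eq_Rintegral => x _.
rewrite /patch indicE; have [Ox|nO] := pselect (Omega x).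
  by rewrite (mem_set Ox); case: (x \in _); rewrite ?mulr0 ?mulr1.
rewrite (memNset nO) (test_function_out tphi nO).1 mul0r.
by case: ifP.
Qed.

Lemma sqint_indic (B : set 'rV[R]_d) : measurable B ->
  sqint (lebesgue_rV d) Omega (\1_B : 'rV[R]_d -> R).
Proof.
move=> mB; apply: (@sqint_bounded _ _ _ _ _ mO Ofin _ 1).
  exact: measurable_indic.
by move=> x _; rewrite indicE normr_nat lern1 leq_b1.
Qed.

(** Rellich's theorem in quantitative form: on the subspace of finite
    codimension where the cell averages vanish, the L2 norm is at most a small
    multiple of the energy. *)
Lemma H10_compact (e : R) : 0 < e ->
  exists (I : finType) (kap : R) (B : I -> set 'rV[R]_d),
    (forall i, measurable (B i)) /\
    forall p, H10 Omega p -> l2_dot Omega p p <= e * dirichlet_form Omega p p +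
      \sum_i (kap * dot (fct p) \1_(B i)) ^+ 2.
Proof.
move=> e0; have [c [ell [ell0 sub]]] := bounded_subset_box bO.
(* comparing an element with an approximating test function costs a factor 4,
   absorbed by the mesh and by the functionals *)
have K0 : 0 < 4 * (2 ^+ d * ell ^+ 2) by rewrite !mulr_gt0 ?exprn_gt0.
have [n] := @ltr_add_invr R 0 (e / (4 * (2 ^+ d * ell ^+ 2))) (divr_gt0 e0 K0).
rewrite add0r => hn.
have m0 := mesh_gt0 n ell0.
have mesh_e : 4 * (2 ^+ d * mesh ell n ^+ 2) <= e.
  move: hn; rewrite ltr_pdivlMr// => /ltW; apply: le_trans.
  rewrite (_ : 4 * _ = n.+1%:R^-1 ^+ 2 * (4 * (2 ^+ d * ell ^+ 2))); last first.
    by rewrite /mesh; ring.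
  rewrite ler_wpM2r ?(ltW K0)//.
  have N0 : 0 < n.+1%:R^-1 :> R by rewrite invr_gt0.
  by rewrite expr2 ler_piMl ?(ltW N0)// invf_le1// ler1n.
pose v := (mesh ell n ^+ d)^-1; have v0 : 0 < v by rewrite invr_gt0 exprn_gt0.
have mcell (z : {ffun 'I_d -> 'I_n.+1}) : measurable (cell c ell z).
  exact: measurable_box.
pose I := {ffun 'I_d -> 'I_n.+1}.
exists I, (2 * Num.sqrt v), (fun z => cell c ell z); split=> // p hp.
have sp := H10_sq hp.
pose A (r : sobolev_pair R d) := \sum_(z : I) v * dot (fct r) \1_(cell c ell z) ^+ 2.
have -> : \sum_(z : I) (2 * Num.sqrt v * dot (fct p) \1_(cell c ell z)) ^+ 2 = 4 * A p.
  rewrite mulr_sumr; apply: eq_bigr => z _.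
  by rewrite !exprMn sqr_sqrtr ?(ltW v0)// mulrA; congr (_ * _ * _); ring.
pose C := \sum_(z : I) v * dot \1_(cell c ell z) \1_(cell c ell z).
have C0 : 0 <= C by apply: sumr_ge0 => z _; rewrite mulr_ge0 ?ip_ge0// ltW.
have AC r : @sq_pair R d Omega r -> A r <= C * l2_dot Omega r r.
  move=> [sr _]; rewrite mulr_suml; apply: ler_sum => z _.
  rewrite -mulrA ler_wpM2l ?(ltW v0)// mulrC.
  exact: (ip_cauchy_schwarz mO sr (sqint_indic (mcell z))).
have A0 r : 0 <= A r.
  by apply: sumr_ge0 => z _; rewrite mulr_ge0 ?sqr_ge0// ltW.
have AD q r : @sq_pair R d Omega q -> @sq_pair R d Omega r ->
    A (sub_pair q r) <= 2 * A q + 2 * A r.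
  move=> [sq _] [sr _]; rewrite /A !mulr_sumr -big_split/=; apply: ler_sum => z _.
  rewrite ipBl//; last exact: sqint_indic.
  rewrite !(mulrCA 2) -mulrDr ler_wpM2l ?(ltW v0)//.
  by move: (dot _ _) (dot _ _) => a b; have := sqr_ge0 (a + b); nra.
rewrite -subr_le0; apply: (@le0_of_small _ _ (2 + e + 4 * C)) => eta eta0 _.
have [phi tphi] := hp.2 eta eta0.
set r := sub_pair p (test_pair phi).
rewrite -[X in X -> _]/(is_true
  (l2_dot Omega r r + dirichlet_form Omega r r < eta)) => hr.
have sphi := test_pair_sq oO bO tphi.
have sr : @sq_pair R d Omega r by exact: sq_sub.
have := test_function_grid_poincare n ell0 sub tphi.
rewrite -[X in X <= _ -> _]/(l2_dot Omega (test_pair phi) (test_pair phi)).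
rewrite -[X in _ + X]/(A (test_pair phi)).
have phiE : sub_pair p r = test_pair phi.
  congr SobolevPair; apply/funext => x /=; first by ring.
  by rewrite subKr.
have phiE' : lin_pair (-1) r p = test_pair phi by rewrite -sub_pairE phiE.
have pE : lin_pair 1 r (test_pair phi) = p.
  rewrite /r; case: (p) => f g; congr SobolevPair; apply/funext => x /=.
    by rewrite mul1r subrK.
  by rewrite scale1r subrK.
have Lp := l2_dot_lin_le oO 1 sr sphi; rewrite pE in Lp.
have Dphi := dirichlet_form_lin_le oO (-1) sr sp; rewrite phiE' in Dphi.
have Aphi := AD _ _ sp sr; rewrite phiE in Aphi.
have Ar := AC _ sr.
have Lr0 := @l2_dot_ge0 R d Omega r; have Dr0 := @dirichlet_form_ge0 R d Omega r.
have Dp0 := @dirichlet_form_ge0 R d Omega p.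
have M0 : 0 <= 2 ^+ d * mesh ell n ^+ 2 by rewrite mulr_ge0 ?exprn_ge0// ltW.
have Ap0 := A0 p.
move: (2 ^+ d * mesh ell n ^+ 2) mesh_e M0 => M Me M0.
move: (l2_dot Omega p p) (dirichlet_form Omega p p) (A p) (l2_dot Omega r r)
  (dirichlet_form Omega r r) (A r) (l2_dot _ _ _) (dirichlet_form _ _ _)
  (A (test_pair phi)) Lp Dphi Aphi Ar hr Lr0 Dr0 Dp0 Ap0.
move: C C0 {AC} => C C0.
clear -Me M0 C0 e0.
move=> Lp Dp Ap Lr Dr Ar Lf Df Af h1 h2 h3 h4 h5 Lr0 Dr0 Dp0 Ap0 h6.
have : M * Df <= M * (2 * Dr + 2 * Dp) by apply: ler_wpM2l => //; lra.
have : C * Lr <= C * eta by apply: ler_wpM2l => //; lra.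
have : (4 * M) * (Dr + Dp) <= e * (Dr + Dp) by apply: ler_wpM2r => //; lra.
have : e * Dr <= e * eta by apply: ler_wpM2l; lra.
by nra.
Qed.

End H10_compact.

(** * The min-max comparison *)

Section H10_module.
Context {R : realType} {d : nat} {Omega : set 'rV[R]_d}.
Hypotheses (oO : open Omega) (bO : bounded_set Omega).

Definition fields : lmodType R := (('rV[R]_d -> R) * ('rV[R]_d -> 'rV[R]_d))%type.

Definition pair_of (p : fields) : sobolev_pair R d := SobolevPair p.1 p.2.

Definition H10_pred : {pred fields} := fun p => `[< H10 Omega (pair_of p) >].

(** The two hypotheses are arguments so that the submodule instance below,
    whose proof depends on them, can be found from the predicate. *)
Definition bounded_H10_pred of open Omega & bounded_set Omega := H10_pred.

Fact H10_pred_submod_closed : submod_closed (bounded_H10_pred oO bO).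
Proof.
split; first by apply/asboolP; exact: H10_0.
move=> a p q /asboolP hp /asboolP hq; apply/asboolP.
exact: (H10_lin oO bO a hp hq).
Qed.

HB.instance Definition _ := GRing.isSubmodClosed.Build R fields
  (bounded_H10_pred oO bO) H10_pred_submod_closed.

Definition H10_space := {p : fields | p \in bounded_H10_pred oO bO}.

HB.instance Definition _ := SubChoice.on H10_space.
HB.instance Definition _ := [SubChoice_isSubLmodule of H10_space by <:].

Definition H10_val (x : H10_space) : sobolev_pair R d := pair_of (val x).

Lemma H10_valP x : H10 Omega (H10_val x).
Proof. by have /asboolP := valP x. Qed.

Lemma H10_of p : H10 Omega p -> exists x, H10_val x = p.
Proof.
move=> hp.
have px : (fct p, grad p) \in bounded_H10_pred oO bO by apply/asboolP; case: p hp.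
by exists (Sub (fct p, grad p) px); rewrite /H10_val SubK; case: (p).
Qed.

Lemma H10_val_lin a x y : H10_val (a *: x + y) = lin_pair a (H10_val x) (H10_val y).
Proof. by []. Qed.

Definition H10_l2 x y := l2_dot Omega (H10_val x) (H10_val y).
Definition H10_energy x y := dirichlet_form Omega (H10_val x) (H10_val y).

Lemma H10_l2_psd : psd_form H10_l2.
Proof.
split; last by move=> x; exact: l2_dot_ge0.
split=> [x y|a x y z]; first exact: l2_dotC.
by rewrite /H10_l2 H10_val_lin (l2_dot_lin oO)//; exact/H10_sq/H10_valP.
Qed.

Lemma H10_energy_psd : psd_form H10_energy.
Proof.
split; last by move=> x; exact: dirichlet_form_ge0.
split=> [x y|a x y z]; first exact: dirichlet_formC.
by rewrite /H10_energy H10_val_lin (dirichlet_form_lin oO)//; exact/H10_sq/H10_valP.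
Qed.

Lemma H10_valB x y : H10_val (x - y) = sub_pair (H10_val x) (H10_val y).
Proof. by []. Qed.

Lemma H10_space_complete : form_complete H10_l2 H10_energy.
Proof.
move=> u cu.
have [||v /H10_of[x <-] hv] := H10_complete oO bO (u := fun n => H10_val (u n)).
- by move=> n; exact: H10_valP.
- exact: cu.
by exists x.
Qed.

Lemma H10_space_compact : form_compact H10_l2 H10_energy.
Proof.
move=> e e0; have [I [kap [B [mB hB]]]] := H10_compact oO bO e0.
exists #|I|, (fun i x => kap *
  ip (lebesgue_rV d) Omega (fct (H10_val x)) \1_(B (enum_val i))).
have mO := open_measurable_rV oO.
have sB i := sqint_indic oO bO (mB i).
have sx x := (H10_sq (H10_valP x)).1.
split=> [i x y|i|x].
- by rewrite H10_valB ipBl// mulrBr.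
- exists (kap ^+ 2 *
    ip (lebesgue_rV d) Omega \1_(B (enum_val i)) \1_(B (enum_val i))) => x.
  rewrite exprMn -mulrA ler_wpM2l ?sqr_ge0// mulrC.
  exact: (ip_cauchy_schwarz mO (sx x) (sB _)).
have := hB _ (H10_valP x); rewrite (reindex (@enum_val I predT))//=.
by exists enum_rank => i _; rewrite ?enum_valK ?enum_rankK.
Qed.

Lemma H10_val_sum (I : Type) (s : seq I) (c : I -> R) (x : I -> H10_space) :
  fct (H10_val (\sum_(i <- s) c i *: x i)) = lincomb s c (fun i => H10_val (x i)).
Proof.
elim: s => [|i s IH].
  by rewrite big_nil; apply/funext => t; rewrite /lincomb big_nil.
apply/funext => t; rewrite big_cons H10_val_lin /lincomb big_cons.
by rewrite -[X in _ = _ + X]/(lincomb s c (fun i => H10_val (x i)) t) -IH.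
Qed.

Lemma l2_dot_ae_eq p q r : @sq_pair R d Omega p -> @sq_pair R d Omega q ->
  @sq_pair R d Omega r -> ae_eq (lebesgue_rV d) Omega (fct p) (fct q) ->
  l2_dot Omega p r = l2_dot Omega q r.
Proof.
move=> [sp _] [sq _] [sr _] pq; rewrite /l2_dot /Rintegral; congr fine.
have mO := open_measurable_rV oO.
apply: ae_eq_integral => //.
- by apply/measurable_EFinP; apply: measurable_funM; [exact: sp.1|exact: sr.1].
- by apply/measurable_EFinP; apply: measurable_funM; [exact: sq.1|exact: sr.1].
by apply: filterS pq => x /[apply] ->.
Qed.

Lemma l2_dot_eq0 p : @sq_pair R d Omega p -> l2_dot Omega p p = 0 ->
  ae_eq (lebesgue_rV d) Omega (fct p) (cst 0).
Proof.
move=> [sp _] p0; have mO := open_measurable_rV oO.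
have m2 : measurable_fun Omega (fun x => (fct p x ^+ 2)%:E).
  by apply/measurable_EFinP; apply: measurable_funX; exact: sp.1.
have : ae_eq (lebesgue_rV d) Omega (fun x => (fct p x ^+ 2)%:E) (cst 0%E).
  apply/(ae_eq_integral_abs (lebesgue_rV d) mO m2).
  under eq_integral do rewrite gee0_abs ?lee_fin ?sqr_ge0//.
  by rewrite -(ipE mO sp) -[ip _ _ _ _]/(l2_dot Omega p p) p0.
apply: filterS => x /[apply] /= -[] /eqP; rewrite sqrf_eq0 => /eqP ->.
by [].
Qed.

End H10_module.

Section minmax.
Context {R : realType} {d : nat} {Omega : set 'rV[R]_d}.
Hypotheses (oO : open Omega) (bO : bounded_set Omega).
Context (V : set (sobolev_pair R d)) (N : nat) (lam lamh : R^nat).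
Hypotheses (VH : V `<=` H10 Omega) (hlam : dirichlet_eigenvalues Omega lam).
Hypothesis hlamh : discrete_eigenvalues Omega V N lamh.

Notation X := (H10_space oO bO).
Notation L := (@H10_l2 R d Omega oO bO).
Notation D := (@H10_energy R d Omega oO bO).

Let hL : psd_form L := H10_l2_psd oO bO.
Let hD : psd_form D := H10_energy_psd oO bO.

(** The eigenvectors are only assumed independent inside each eigenspace; the
    orthogonality of distinct eigenspaces makes the whole family independent. *)
Lemma discrete_eigenvectors : exists W : nat -> X,
  (forall i j, (i < N)%N -> (j < N)%N -> D (W i) (W j) = lamh i * L (W i) (W j)) /\
  forall (P : pred 'I_N) (c : nat -> R),
    L (\sum_(i < N | P i) c i *: W i) (\sum_(i < N | P i) c i *: W i) = 0 ->
    forall i, P i -> c i = 0.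
Proof.
have [_ _ [uh huh]] := hlamh.
have : forall i, exists x : X, forall h : (i < N)%N, H10_val x = uh (Ordinal h).
  move=> i; have [h|h] := pselect (i < N)%N; last first.
    by exists 0 => h'; exfalso; exact: h.
  have [uV _ _] := huh (lamh i).
  have [x hx] := H10_of oO bO (VH (uV (Ordinal h) (eqxx _)).1).
  by exists x => h'; rewrite hx (bool_irrelevance h h').
move=> /choice[W hW].
have WE (i : 'I_N) : H10_val (W i) = uh i.
  by rewrite (hW i (ltn_ord i)); congr uh; exact: val_inj.
have eigW i j : (i < N)%N -> (j < N)%N -> D (W i) (W j) = lamh i * L (W i) (W j).
  move=> iN jN; rewrite /H10_energy /H10_l2 (hW i iN) (hW j jN).
  have [uV _ _] := huh (lamh i); have [uV' _ _] := huh (lamh j).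
  by have [_] := uV (Ordinal iN) (eqxx _); apply; have [] := uV' (Ordinal jN) (eqxx _).
exists W; split=> // P c uu0 i0 Pi0.
set u := \sum_(i < N | P i) c i *: W i in uu0.
pose ul := \sum_(i < N | P i && (lamh i == lamh i0)) c i *: W i.
pose ur := \sum_(i < N | P i && (lamh i != lamh i0)) c i *: W i.
have uE : u = ul + ur by rewrite /u (bigID (fun i : 'I_N => lamh i == lamh i0)).
have lr0 : L ul ur = 0.
  rewrite (form_suml hL.1) big1// => i /andP[_ /eqP il].
  rewrite (form_sumr hL.1) big1// => j /andP[_ jl].
  rewrite (formZl hL.1) (formZr hL.1).
  suff -> : L (W i) (W j) = 0 by rewrite !mulr0.
  have := eigW i j (ltn_ord i) (ltn_ord j).
  rewrite (formC hD.1) eigW ?ltn_ord// (formC hL.1 (W j)) => /eqP.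
  by rewrite -subr_eq0 -mulrBl mulf_eq0 subr_eq0 il (negPf jl) => /eqP.
have ll0 : L ul ul = 0.
  have := form_isotropic ul hL uu0.
  by rewrite uE (formDl hL.1) (formC hL.1 ur) lr0 addr0.
have [_ free _] := huh (lamh i0).
pose s := [seq i <- index_enum 'I_N | P i && (lamh i == lamh i0)].
have := free s (fun i => c i) _ _ _ i0; apply.
- by rewrite filter_uniq// index_enum_uniq.
- by apply/allP => i; rewrite mem_filter => /andP[/andP[]].
- have := l2_dot_eq0 oO (H10_sq (H10_valP ul)) ll0.
  rewrite /ul -big_filter H10_val_sum; congr ae_eq.
  by apply/funext => t; apply: eq_bigr => i _; rewrite WE.
by rewrite mem_filter Pi0 eqxx mem_index_enum.
Qed.

(** Dimension count: [k + 1] unknowns for [k] linear equations. *)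
Lemma kernel_vector k (F : nat -> nat -> R) : exists c : nat -> R,
  (exists2 j, (j < k.+1)%N & c j != 0) /\
  forall t, (t < k)%N -> \sum_(j < k.+1) c j * F j t = 0.
Proof.
pose A : 'M[R]_(k.+1, k) := \matrix_(j, t) F j t.
have : kermx A != 0.
  rewrite kermx_eq0 -row_leq_rank -ltnNge ltnS; exact: rank_leq_col.
move=> /rowV0Pn[v /sub_kermxP vA v0].
exists (fun j => v 0 (inord j)); split.
  have [j vj] : exists j, v 0 j != 0.
    by move/rV0Pn: v0.
  by exists j; [exact: ltn_ord|rewrite inord_val].
move=> t tk; have := congr1 (fun M : 'rV[R]_k => M 0 (Ordinal tk)) vA.
rewrite !mxE => vAt; rewrite -[RHS]vAt; apply: eq_bigr => j _.
by rewrite !mxE inord_val.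
Qed.

(** The min-max principle. Otherwise some combination [u] of the first [k + 1]
    discrete eigenvectors is orthogonal to the first [k] eigenfunctions and has
    a Rayleigh quotient below [lam k]; so has the minimiser [v] on their
    orthogonal, which is an eigenfunction and thus a combination of
    eigenfunctions to which it is orthogonal. *)
Lemma eigenvalue_le k : (k < N)%N -> lam k <= lamh k.
Proof.
move=> kN; rewrite leNgt; apply/negP => lt_lam.
have [_ _ hmono _ [ue hue]] := hlam.
have [_ hhmono _] := hlamh.
have ueH i : H10 Omega (ue i) /\ forall q, H10 Omega q ->
    dirichlet_form Omega (ue i) q = lam i * l2_dot Omega (ue i) q.
  by have [uV _ _] := hue (lam i); exact: uV (eqxx _).
have /choice[e he] : forall i, exists x : X, H10_val x = ue i.
  by move=> i; exact: H10_of (ueH i).1.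
pose E := mkseq e k.
have hE (f : X) : f \in E -> exists l, forall q, D f q = l * L f q.
  move=> /mapP[i _ ->]; exists (lam i) => q.
  by rewrite /H10_energy /H10_l2 he; apply: (ueH i).2; exact: H10_valP.
have [W [eigW freeW]] := discrete_eigenvectors.
have [c [[j0 j0k cj0] hc]] := kernel_vector k (fun j t => L (W j) (e t)).
have widen (F : nat -> X) : \sum_(i < k.+1) F i = \sum_(i < N | (i < k.+1)%N) F i.
  by rewrite (big_ord_widen N).
pose u := \sum_(i < k.+1) c i *: W i.
have uE (f : X) : f \in E -> L u f = 0.
  move=> /mapP[t]; rewrite mem_iota add0n => /andP[_ tk] ->.
  rewrite (form_suml hL.1) -[RHS](hc t tk); apply: eq_bigr => j _.
  by rewrite (formZl hL.1).
have iN (i : 'I_k.+1) : (i < N)%N by exact: leq_trans (ltn_ord i) kN.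
have u0 : 0 < L u u.
  rewrite lt_neqAle hL.2 andbT; apply/eqP => uu0.
  have := freeW (fun i : 'I_N => (i < k.+1)%N) c.
  rewrite -(widen (fun i => c i *: W i)) => /(_ (esym uu0)).
  have j0N : (j0 < N)%N by exact: leq_trans j0k kN.
  by move=> /(_ (Ordinal j0N) j0k)/eqP; rewrite (negPf cj0).
have uk : D u u <= lamh k * L u u.
  rewrite -subr_ge0.
  (* [a i * a j] may replace [lamh k - lamh i] in front of [L (W i) (W j)],
     which vanishes unless [lamh i = lamh j] *)
  pose a i := Num.sqrt (lamh k - lamh i).
  rewrite (_ : _ - _ = L (\sum_(i < k.+1) a i *: (c i *: W i))
      (\sum_(i < k.+1) a i *: (c i *: W i))); first exact: hL.2.
  rewrite (form_suml hL.1) (form_suml hD.1) (form_suml hL.1) mulr_sumr -sumrB.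
  apply: eq_bigr => i _.
  rewrite (form_sumr hL.1) (form_sumr hD.1) (form_sumr hL.1) mulr_sumr -sumrB.
  apply: eq_bigr => j _.
  rewrite (formZl hD.1 (c i)) (formZr hD.1) eigW//.
  rewrite (formZl hL.1 (a i)) (formZr hL.1 (a j)).
  rewrite (formZl hL.1 (c i)) (formZr hL.1 (c j)).
  have [l0|ln0] := eqVneq (L (W i) (W j)) 0; first by rewrite l0 !mulr0 subrr.
  have aij : a i = a j.
    rewrite /a; congr (Num.sqrt (_ - _)).
    have := eigW i j (iN i) (iN j).
    rewrite (formC hD.1) eigW// (formC hL.1 (W j)) => /eqP.
    by rewrite -subr_eq0 -mulrBl mulf_eq0 (negPf ln0) orbF subr_eq0 eq_sym => /eqP.
  have aa : a j * a j = lamh k - lamh i.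
    rewrite -{1}aij -aij -expr2 sqr_sqrtr// subr_ge0; apply: hhmono.
    by rewrite -ltnS ltn_ord kN.
  by rewrite aij [a j * (a j * _)]mulrA aa; ring.
have Ray0 : [set D x x | x in [set x : X | (forall f : X, f \in E -> L x f = 0) /\
    L x x = 1]] !=set0.
  exists (D ((Num.sqrt (L u u))^-1 *: u) ((Num.sqrt (L u u))^-1 *: u)).
  exists ((Num.sqrt (L u u))^-1 *: u) => //; split.
    move=> f fE; rewrite (formZl hL.1).
    have -> : L u f = 0 := uE f fE.
    by rewrite mulr0.
  by rewrite (form_sqrZ hL.1) exprVn sqr_sqrtr ?(ltW u0)// mulVf// gt_eqF.
have [l [v [hl v1 vE vl]]] := eigenvector_minimizer hL hD hE Ray0
  (@H10_space_complete R d Omega oO bO) (@H10_space_compact R d Omega oO bO).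
have lk : l < lam k.
  apply: le_lt_trans lt_lam; rewrite -(ler_pM2r u0).
  exact: le_trans (hl u uE) uk.
have [_ _ span] := hue l.
have vH : eigenspace_in Omega (H10 Omega) l (H10_val v).
  split; first exact: H10_valP.
  by move=> q /(H10_of oO bO)[y <-]; exact: vl.
have [s [b [/allP sl ae_v]]] := span _ vH.
pose x := \sum_(i <- s) b i *: e i.
have vx : L v v = L x v.
  apply: (l2_dot_ae_eq oO); try exact: H10_sq (H10_valP _).
  rewrite H10_val_sum; move: ae_v; congr ae_eq; apply/funext => t.
  by apply: eq_bigr => i _; rewrite he.
have : L x v = 0.
  rewrite (form_suml hL.1) big_seq big1// => i /sl/eqP il.
  rewrite (formZl hL.1) (formC hL.1) vE ?mulr0//.
  apply: map_f; rewrite mem_iota add0n /= ltnNge; apply/negP => ki.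
  by have := hmono _ _ ki; rewrite il leNgt lk.
by rewrite -vx v1 => /eqP; rewrite oner_eq0.
Qed.

End minmax.

(** * Weighted Laplace spaces *)

Section laplace_spaces.
Context {R : realType}.
Local Notation mu1 := (@lebesgue_measure R).
Local Notation Rpos := (`]0%R, +oo[%classic : set (measurableTypeR R)).
Implicit Types (w psi g : R -> R) (lam : R^nat).

Let mRpos : measurable Rpos. Proof. exact: measurable_itv. Qed.

Let measurable_expRM (c : R) (D : set (measurableTypeR R)) :
  measurable_fun D (fun x : measurableTypeR R => expR (- x * c)).
Proof.
apply: measurable_funTS; apply: (measurableT_comp (@measurable_expR R)).
apply: measurable_funM => //; apply: measurableT_comp => //.
Qed.

Let integral_dirac_exp (a t : R) : 0 < a ->
  (\int[\d_a]_(x in Rpos) (expR (- x * t))%:E = (expR (- a * t))%:E)%E.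
Proof.
move=> a0; rewrite integral_dirac//; last first.
  by apply/measurable_EFinP; exact: measurable_expRM.
by rewrite diracE mem_set ?mul1e//= in_itv/= a0.
Qed.

Lemma laplace_discrete_spectral_measure N lam t : (forall i, (i < N)%N -> 0 < lam i) ->
  laplace_measure (discrete_spectral_measure N lam) t =
  (\sum_(k < N) expR (- lam k * t))%:E.
Proof.
move=> lam0; rewrite /laplace_measure /discrete_spectral_measure.
rewrite ge0_integral_measure_sum//; last first.
  by apply/measurable_EFinP; exact: measurable_expRM.
rewrite -sumEFin; apply: eq_bigr => k _.
exact: (integral_dirac_exp t (lam0 k (ltn_ord k))).
Qed.

Lemma laplace_spectral_measure_ge N lam t : (forall i, 0 < lam i) ->
  ((\sum_(k < N) expR (- lam k * t))%:E <= laplace_measure (spectral_measure lam) t)%E.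
Proof.
move=> lam0; rewrite /laplace_measure /spectral_measure.
rewrite ge0_integral_measure_series//; last first.
  by apply/measurable_EFinP; exact: measurable_expRM.
apply: (@le_trans _ _ (\sum_(0 <= k < N)
    \int[\d_(lam k)]_(x in Rpos) (expR (- x * t))%:E)%E).
  rewrite big_mkord -sumEFin; apply: lee_sum => k _.
  by rewrite [leRHS](integral_dirac_exp t (lam0 k)).
apply: nneseries_lim_ge => k _ _; apply: integral_ge0 => x _.
by rewrite lee_fin expR_ge0.
Qed.

Lemma Hw_dual_sqnorm_le w N lam lamh : weight w -> (forall i, 0 < lam i) ->
  (forall i, (i < N)%N -> lam i <= lamh i) ->
  (Hw_dual_sqnorm w (discrete_spectral_measure N lamh) <=
   Hw_dual_sqnorm w (spectral_measure lam))%E.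
Proof.
move=> [_ w0 _] lam0 le_lam.
have lamh0 i : (i < N)%N -> 0 < lamh i.
  by move=> iN; exact: lt_le_trans (lam0 i) (le_lam i iN).
apply: ge0_le_lower_integral => t /=; rewrite in_itv/= andbT => t0.
  by rewrite mule_ge0 ?sqre_ge0// lee_fin w0.
apply: lee_wpmul2r; first by rewrite lee_fin w0.
have le_Z : (laplace_measure (discrete_spectral_measure N lamh) t <=
    laplace_measure (spectral_measure lam) t)%E.
  rewrite laplace_discrete_spectral_measure//.
  apply: le_trans (laplace_spectral_measure_ge N t lam0).
  rewrite lee_fin; apply: ler_sum => k _.
  by rewrite ler_expR !mulNr lerN2 ler_wpM2r ?(ltW t0)// le_lam.
have Z0 : (0 <= laplace_measure (discrete_spectral_measure N lamh) t)%E.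
  by apply: integral_ge0 => x _; rewrite lee_fin expR_ge0.
exact: lee_pmul.
Qed.

(** For [psi] the Laplace transform of [g], the sum of the values of [psi] is
    the L2 product of [sqrt w * Z_n] and [g / sqrt w], where [Z_n] is the sum
    of the first [n] exponentials. *)
Lemma Hw_sum_le w psi N n lam : weight w -> laplace_weight w -> Hw w psi ->
  (forall i, (i < N)%N -> 0 < lam i) -> (n <= N)%N ->
  Hw_dual w (discrete_spectral_measure N lam) ->
  `|\sum_(k < n) psi (lam k)| <=
    Hw_norm w psi * Hw_dual_norm w (discrete_spectral_measure N lam).
Proof.
move=> [mw w0 wpos] lw hpsi lam0 nN hdual.
pose g := xget (cst 0) (laplace_density w psi).
have [mg g2 psig] : laplace_density w psi g by exact: xgetPex hpsi.
rewrite /Hw_norm -/g.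
have msqrt : measurable_fun Rpos (fun t => Num.sqrt (w t)).
  apply: measurableT_comp mw.
  by apply: continuous_measurable_fun; exact: sqrt_continuous.
pose a k t := Num.sqrt (w t) * expR (- lam k * t).
(* [b ^+ 2] and [g ^+ 2 / w] agree also where [w] vanishes: both are 0 there *)
pose b t := g t * (w t) `^ (- 2^-1).
have wt0 t : Rpos t -> 0 <= w t by rewrite /= in_itv/= andbT => /w0.
have bE t : Rpos t -> b t ^+ 2 = g t ^+ 2 / w t.
  move=> /wt0 wt; rewrite /b powRN powR12_sqrt// exprMn exprVn sqr_sqrtr//.
have sb : sqint mu1 Rpos b.
  split; last first.
    apply: le_lt_trans g2; rewrite le_eqVlt; apply/orP; left; apply/eqP.
    by apply: eq_integral => t /set_mem/bE ->.
  apply: measurable_funM => //.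
  exact: (measurableT_comp (@measurable_powR R (- 2^-1)) mw).
have sa k : (k < N)%N -> sqint mu1 Rpos (a k).
  move=> kN; split; last exact: (lw _ (lam0 k kN)).
  apply: measurable_funM => //; apply: measurable_funTS.
  apply: (measurableT_comp (@measurable_expR R)).
  exact: measurable_funM.
have kN (k : 'I_n) : (k < N)%N by exact: leq_trans (ltn_ord k) nN.
pose A t := \sum_(k < n) a k t.
have sA : sqint mu1 Rpos A by apply: sqint_sum => // k; exact: sa.
have sumE : \sum_(k < n) psi (lam k) = ip mu1 Rpos A b.
  rewrite (ip_suml mRpos _ (F := fun k : 'I_n => a k))// => [|k]; last exact: sa.
  apply: eq_bigr => k _; rewrite psig ?lam0//; congr fine.
  apply: ae_eq_integral => //.
  - apply/measurable_EFinP; apply: measurable_funM => //; apply: measurable_funTS.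
    apply: (measurableT_comp (@measurable_expR R)); exact: measurable_funM.
  - apply/measurable_EFinP; apply: measurable_funM; last exact: sb.1.
    exact: (sa _ (kN k)).1.
  have [M [mM M0 sub]] := wpos; exists M; split=> // t nt; apply: sub => wt.
  apply: nt => /=; rewrite in_itv/= andbT => t0; congr (_%:E).
  have {}wt := wt t0; have n0 : Num.sqrt (w t) != 0 by rewrite gt_eqF// sqrtr_gt0.
  by rewrite /a /b powRN powR12_sqrt ?ltW//; field.
have bb : ip mu1 Rpos b b = fine (sqnorm_winv w g).
  congr fine; apply: eq_integral => t /set_mem/bE <-.
  by rewrite expr2.
have AA : ip mu1 Rpos A A <= fine (Hw_dual_sqnorm w (discrete_spectral_measure N lam)).
  have dual0 : (0 <= Hw_dual_sqnorm w (discrete_spectral_measure N lam))%E.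
    apply: integral_ge0 => t /wt0 wt.
    by rewrite mule_ge0 ?sqre_ge0// lee_fin.
  rewrite -lee_fin (ipE mRpos sA) [leRHS]fineK ?ge0_fin_numE//.
  apply: ge0_le_lower_integral => t Rt; first by rewrite lee_fin sqr_ge0.
  rewrite laplace_discrete_spectral_measure// -EFin_expe -EFinM lee_fin.
  rewrite /A /a -mulr_sumr exprMn sqr_sqrtr ?wt0// mulrC ler_wpM2r ?wt0//.
  rewrite lerXn2r ?nnegrE ?sumr_ge0//; try by move=> k _; exact: expR_ge0.
  rewrite (big_ord_widen N (fun k => expR (- lam k * t)))//.
  rewrite [leRHS](bigID (fun k : 'I_N => (k < n)%N))/=.
  by rewrite lerDl sumr_ge0// => k _; exact: expR_ge0.
have := ip_cauchy_schwarz mRpos sA sb.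
rewrite sumE -bb -sqrtr_sqr => /ler_wsqrtr/le_trans; apply.
rewrite /Hw_dual_norm -sqrtrM ?ip_ge0// mulrC.
by apply: ler_wsqrtr; apply: ler_wpM2l => //; exact: ip_ge0.
Qed.

End laplace_spaces.

(** * Comparison of the spectral sums *)

Theorem mainTheorem2 (R : realType) (d : nat) (Omega : set 'rV[R]_d.+1)
    (N : nat) (Vh : set (sobolev_pair R d.+1)) (lam lamh : R^nat)
    (w : R -> R) :
  bounded_lipschitz_domain Omega ->
  dirichlet_eigenvalues Omega lam ->
  conforming_space Omega N Vh ->
  discrete_eigenvalues Omega Vh N lamh ->
  weight w ->
  laplace_weight w ->
  let mu := spectral_measure lam in
  let mu_h := discrete_spectral_measure N lamh in
  Hw_dual w mu ->
  Hw_dual w mu_h ->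
  forall psi : R -> R, Hw w psi ->
  forall n : nat, (1 <= n <= N)%N ->
    `|\sum_(k < n) psi (lamh k)| <= Hw_norm w psi * Hw_dual_norm w mu_h /\
    Hw_norm w psi * Hw_dual_norm w mu_h <= Hw_norm w psi * Hw_dual_norm w mu.
Proof.
move=> [_ oO _ bO _] hlam [VH _ _] hlamh hw lw mu mu_h dual_mu dual_mu_h psi hpsi n.
move=> /andP[_ nN].
have [lam0 _ hmono _ _] := hlam; have [lamh0 _ _] := hlamh.
have lam_gt0 i : 0 < lam i by apply: lt_le_trans lam0 _; exact: hmono.
split; first exact: Hw_sum_le.
apply: ler_wpM2l; first exact: sqrtr_ge0.
have le_norm := Hw_dual_sqnorm_le hw lam_gt0 (eigenvalue_le oO bO VH hlam hlamh).
have dual_ge0 nu : (0 <= Hw_dual_sqnorm w nu)%E.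
  apply: integral_ge0 => t; rewrite /= in_itv/= andbT => t0.
  by rewrite mule_ge0 ?sqre_ge0// lee_fin; case: hw => _ /(_ t t0).
by apply: ler_wsqrtr; apply: fine_le; rewrite ?ge0_fin_numE.
Qed.
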